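(* Consider the Kovalevskaya top in a double constant force field, with phase space $P$, functions $x_i,z_i$, first integrals $M,L$ and set $N\subset P$ as defined in the context. Let $m,\ell$ be real constants with $m\ne0$. In the domain $x_1x_2\neq0$, the change of variables $$s_1=\frac{x_1x_2+z_1z_2+r^2}{2\sqrt{x_1x_2}},\qquad s_2=\frac{x_1x_2+z_1z_2-r^2}{2\sqrt{x_1x_2}}$$ reduces the equations of motion on the integral manifold $$J_{m,\ell}=\{M=m,\ L=\ell\}\subset N$$ to the system $$\frac{ds_1}{dt}=\frac12\sqrt{(a^2-s_1^2)\,\Phi(s_1)},\qquad \frac{ds_2}{dt}=\frac12\sqrt{(b^2-s_2^2)\,\Phi(s_2)},$$ where $$\Phi(s)=4ms^2-4\ell s+\frac{\ell^2-1}{m}.$$ The solutions of this system can be written explicitly in terms of elliptic functions.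
   Context: A rigid body with a fixed point has principal moments of inertia $\mathbf I=\operatorname{diag}\{2,2,1\}$ and moves in the force field with potential $U=-(\mathbf e_1,\boldsymbol\alpha)-(\mathbf e_2,\boldsymbol\beta)=-(\alpha_1+\beta_2)$, where $\mathbf e_1,\mathbf e_2$ are orthonormal along the principal axes in the equatorial plane (the plane of the two equal moments of inertia), and $\boldsymbol\alpha,\boldsymbol\beta$ are mutually orthogonal vectors fixed in the inertial space with $\boldsymbol\alpha^2=a^2$, $\boldsymbol\beta^2=b^2$, $a>b>0$. Put $p^2=a^2+b^2$, $r^2=a^2-b^2$ ($p,r>0$). Let $\omega_k,\alpha_k,\beta_k$ ($k=1,2,3$) be the components, in the principal body frame, of the angular velocity and of $\boldsymbol\alpha,\boldsymbol\beta$. The phase space is the six-dimensional manifold $$P=\{(\boldsymbol\omega,\boldsymbol\alpha,\boldsymbol\beta)\in\mathbb R^9:\ \boldsymbol\alpha^2=a^2,\ \boldsymbol\beta^2=b^2,\ \boldsymbol\alpha\cdot\boldsymbol\beta=0\},$$ and the equations of motion (Euler–Poisson equations) are $$2\dot\omega_1=\omega_2\omega_3+\beta_3,\quad 2\dot\omega_2=-\omega_1\omega_3-\alpha_3,\quad \dot\omega_3=\alpha_2-\beta_1,\quad \dot{\boldsymbol\alpha}=\boldsymbol\alpha\times\boldsymbol\omega,\quad \dot{\boldsymbol\beta}=\boldsymbol\beta\times\boldsymbol\omega .$$ First integrals: $$H=\omega_1^2+\omega_2^2+\tfrac12\omega_3^2-(\alpha_1+\beta_2),$$ $$K=(\omega_1^2-\omega_2^2+\alpha_1-\beta_2)^2+(2\omega_1\omega_2+\alpha_2+\beta_1)^2,$$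 $$G=\tfrac14(\omega_\alpha^2+\omega_\beta^2)+\tfrac12\omega_3\omega_\gamma-b^2\alpha_1-a^2\beta_2,$$ where $$\omega_\alpha=2\omega_1\alpha_1+2\omega_2\alpha_2+\omega_3\alpha_3,\qquad \omega_\beta=2\omega_1\beta_1+2\omega_2\beta_2+\omega_3\beta_3,$$ $$\omega_\gamma=2\omega_1(\alpha_2\beta_3-\alpha_3\beta_2)+2\omega_2(\alpha_3\beta_1-\alpha_1\beta_3)+\omega_3(\alpha_1\beta_2-\alpha_2\beta_1).$$ Further first integrals: $$F=(2G-p^2H)^2-r^4K,\qquad M=(2G-p^2H)/r^4,\qquad L=\sqrt{2p^2M^2+2HM+1}.$$ $N\subset P$ denotes the set of critical points of $F$ (points of $P$ where the differential of $F$ as a function on $P$ vanishes) on the level $F=0$; it is invariant under the flow. Complex variables ($i^2=-1$, bar denotes complex conjugation): $$x_1=(\alpha_1-\beta_2)+i(\alpha_2+\beta_1),\ x_2=\overline{x_1},\quad z_1=\alpha_3+i\beta_3,\ z_2=\overline{z_1}.$$ Sign conventions for radicals. The function $L$ is the nonnegative root. The radical $\sqrt{x_1x_2}$ in the definition of $s_1,s_2$ is a real square root of $x_1x_2=|x_1|^2>0$, continuous along the motion, whose sign is chosen so that on $J_{m,\ell}$ $$m(x_1x_2+z_1z_2)-\ell\sqrt{x_1x_2}+\sqrt{m^2r^4-mr^2(x_1+x_2)+x_1x_2}=0$$ with the last radical nonnegative (for $\ell=0$ either sign may be taken). The radicals on the right-hand sides of the differential equations are two-valued: the equations mean that along each motion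 on $J_{m,\ell}$ in the domain $x_1x_2\ne0$ one has $4\dot s_1^2=(a^2-s_1^2)\Phi(s_1)$ and $4\dot s_2^2=(b^2-s_2^2)\Phi(s_2)$, the signs of $\dot s_1,\dot s_2$ being those of the corresponding branches. *)

(* Defs.v *)
(* Stdlib real numbers with Coquelicot. *)
From Stdlib Require Import Reals.
From Coquelicot Require Import Coquelicot.
Open Scope R_scope.

Definition vec3 : Type := (R * R * R)%type.

Definition c1 (v : vec3) : R := fst (fst v).
Definition c2 (v : vec3) : R := snd (fst v).
Definition c3 (v : vec3) : R := snd v.

Definition dot (u v : vec3) : R := c1 u * c1 v + c2 u * c2 v + c3 u * c3 v.

Definition cross (u v : vec3) : vec3 :=
  (c2 u * c3 v - c3 u * c2 v,
   c3 u * c1 v - c1 u * c3 v,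
   c1 u * c2 v - c2 u * c1 v).

(* (angular velocity, alpha, beta), in the principal body frame *)
Definition state : Type := (vec3 * vec3 * vec3)%type.

Definition om (q : state) : vec3 := fst (fst q).
Definition al (q : state) : vec3 := snd (fst q).
Definition be (q : state) : vec3 := snd q.

Definition phase_space (a b : R) (q : state) : Prop :=
  dot (al q) (al q) = a ^ 2 /\ dot (be q) (be q) = b ^ 2 /\
  dot (al q) (be q) = 0.

Definition euler_poisson (q : state) : state :=
  (((c2 (om q) * c3 (om q) + c3 (be q)) / 2,
    (- (c1 (om q) * c3 (om q)) - c3 (al q)) / 2,
    c2 (al q) - c1 (be q)),
   cross (al q) (om q),
   cross (be q) (om q)).

Definition in_interval (lo hi : Rbar) (t : R) : Prop :=
  Rbar_lt lo t /\ Rbar_lt t hi.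

Definition motion_on (lo hi : Rbar) (q : R -> state) : Prop :=
  forall t : R, in_interval lo hi t -> is_derive q t (euler_poisson (q t)).

Definition pc (a b : R) : R := sqrt (a ^ 2 + b ^ 2).
Definition rc (a b : R) : R := sqrt (a ^ 2 - b ^ 2).

Definition H (q : state) : R :=
  c1 (om q) ^ 2 + c2 (om q) ^ 2 + c3 (om q) ^ 2 / 2 - (c1 (al q) + c2 (be q)).

Definition K (q : state) : R :=
  (c1 (om q) ^ 2 - c2 (om q) ^ 2 + c1 (al q) - c2 (be q)) ^ 2 +
  (2 * c1 (om q) * c2 (om q) + c2 (al q) + c1 (be q)) ^ 2.

(* The angular momentum, for the moments of inertia 2, 2, 1. *)
Definition momentum (q : state) : vec3 :=
  (2 * c1 (om q), 2 * c2 (om q), c3 (om q)).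

Definition om_alpha (q : state) : R := dot (momentum q) (al q).
Definition om_beta (q : state) : R := dot (momentum q) (be q).
Definition om_gamma (q : state) : R := dot (momentum q) (cross (al q) (be q)).

Definition G (a b : R) (q : state) : R :=
  (om_alpha q ^ 2 + om_beta q ^ 2) / 4 + c3 (om q) * om_gamma q / 2
  - b ^ 2 * c1 (al q) - a ^ 2 * c2 (be q).

Definition F (a b : R) (q : state) : R :=
  (2 * G a b q - pc a b ^ 2 * H q) ^ 2 - rc a b ^ 4 * K q.

Definition M (a b : R) (q : state) : R :=
  (2 * G a b q - pc a b ^ 2 * H q) / rc a b ^ 4.

Definition L_radicand (a b : R) (q : state) : R :=
  2 * pc a b ^ 2 * M a b q ^ 2 + 2 * H q * M a b q + 1.

Definition L (a b : R) (q : state) : R := sqrt (L_radicand a b q).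

(* The differential at q of f, as a function on the phase space, is zero:
   f has zero velocity at q along every curve lying in the phase space. *)
Definition critical_on_phase_space (a b : R) (f : state -> R) (q : state)
  : Prop :=
  forall gam : R -> state,
    (forall t : R, phase_space a b (gam t)) -> gam 0 = q ->
    ex_derive gam 0 ->
    is_derive (fun t : R => f (gam t)) 0 0.

Definition N (a b : R) (q : state) : Prop :=
  phase_space a b q /\ F a b q = 0 /\ critical_on_phase_space a b (F a b) q.

(* L is only defined where its radicand is nonnegative, whereas sqrt is total
   (zero on negative numbers); hence the sign condition. *)
Definition J (a b m l : R) (q : state) : Prop :=
  N a b q /\ M a b q = m /\ 0 <= L_radicand a b q /\ L a b q = l.

Definition x1 (q : state) : C :=
  (c1 (al q) - c2 (be q), c2 (al q) + c1 (be q)).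
Definition x2 (q : state) : C := Cconj (x1 q).
Definition z1 (q : state) : C := (c3 (al q), c3 (be q)).
Definition z2 (q : state) : C := Cconj (z1 q).

(* x1 x2, z1 z2 and x1 + x2 have imaginary part zero: Re is only a cast to R. *)
Definition xx (q : state) : R := Re (x1 q * x2 q)%C.
Definition zz (q : state) : R := Re (z1 q * z2 q)%C.
Definition xsum (q : state) : R := Re (x1 q + x2 q)%C.

(* sg is an admissible choice of the radical sqrt (x1 x2) along the motion q:
   a continuous real square root with the prescribed sign.  Under the sqrt
   below stands |m r^2 - x1|^2. *)
Definition radical_along (a b m l : R) (lo hi : Rbar) (q : R -> state)
    (sg : R -> R) : Prop :=
  forall t : R, in_interval lo hi t ->
    continuous sg t /\
    sg t ^ 2 = xx (q t) /\
    m * (xx (q t) + zz (q t)) - l * sg t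
      + sqrt (m ^ 2 * rc a b ^ 4 - m * rc a b ^ 2 * xsum (q t) + xx (q t)) = 0.

Definition s1 (a b : R) (q : state) (sg : R) : R :=
  (xx q + zz q + rc a b ^ 2) / (2 * sg).
Definition s2 (a b : R) (q : state) (sg : R) : R :=
  (xx q + zz q - rc a b ^ 2) / (2 * sg).

Definition Phi (m l s : R) : R := 4 * m * s ^ 2 - 4 * l * s + (l ^ 2 - 1) / m.

(* ds/dt = (1/2) sqrt ((c^2 - s^2) Phi s) with a two-valued radical, hence in
   squared form.  The squared equation alone also has non-analytic solutions
   that rest for a while at a simple root of the right-hand side and then leave
   it; these come from no motion, and asking for class C^2 excludes them. *)
Definition separated_equation (c m l : R) (lo hi : Rbar) (s : R -> R) : Prop :=
  exists s' s'' : R -> R,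
    forall t : R, in_interval lo hi t ->
      is_derive s t (s' t) /\ is_derive s' t (s'' t) /\ continuous s'' t /\
      4 * s' t ^ 2 = (c ^ 2 - s t ^ 2) * Phi m l (s t).

Definition separated_system (a b m l : R) (lo hi : Rbar) (u v : R -> R)
  : Prop :=
  separated_equation a m l lo hi u /\ separated_equation b m l lo hi v.

(* am is Jacobi's amplitude of modulus k: the inverse function of the elliptic
   integral of the first kind. *)
Definition is_amplitude (k : R) (am : R -> R) : Prop :=
  forall u : R,
    is_RInt (fun th : R => / sqrt (1 - k ^ 2 * sin th ^ 2)) 0 (am u) u.

Definition sn (am : R -> R) (u : R) : R := sin (am u).
Definition cn (am : R -> R) (u : R) : R := cos (am u).

(* s is a fractional linear function of a Jacobi function sn or cn of modulus k
   and of an argument linear in time. *)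
Definition jacobi_form (k : R) (lo hi : Rbar) (s : R -> R) : Prop :=
  exists (am e : R -> R) (A0 A1 B0 B1 nu t0 : R),
    is_amplitude k am /\ (e = sn am \/ e = cn am) /\
    forall t : R, in_interval lo hi t ->
      B0 + B1 * e (nu * (t - t0)) <> 0 /\
      s t = (A0 + A1 * e (nu * (t - t0))) / (B0 + B1 * e (nu * (t - t0))).

(* The modulus is nondegenerate (0 < k < 1, so that sn and cn are restrictions
   to the real axis of doubly periodic functions) unless (c^2 - s^2) Phi s has a
   multiple root.  The roots (l + 1) / (2 m) and (l - 1) / (2 m) of Phi being
   distinct, this happens only when c or - c is a root of Phi; the elliptic
   functions may then degenerate to trigonometric (k = 0) or hyperbolic (k = 1)
   ones. *)
Definition elliptic_in_time (c m l : R) (lo hi : Rbar) (s : R -> R) : Prop :=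
  exists k : R,
    0 <= k <= 1 /\
    (Phi m l c <> 0 -> Phi m l (- c) <> 0 -> 0 < k < 1) /\
    jacobi_form k lo hi s.

(* Main.v *)
Require Import Defs.
From Stdlib Require Import Reals Lra Psatz ClassicalEpsilon.
From Coquelicot Require Import Coquelicot.
Import Defs.
Open Scope R_scope.

(** Why the theorem is true.

    _Separation._  Write w1 = om1 + i om2, W = |w1|^2, n = x1 x2 = |x1|^2,
    r^2 = a^2 - b^2 and f = 2 G - p^2 H.  Modulo the geometric constraints,
      2 n f = 2 r^2 Re (x2^2 (w1^2 + x1)) - S^2,   S = 2 Re (x2 z1 w1) - n om3,
    and n^2 K = |x2^2 (w1^2 + x1)|^2 ([M_numerator_identity], [K_identity]).
    Only S depends on om3, so moving om3 alone gives dF/dom3 = 2 f S.  On the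
    level M = m the number f = m r^4 is not zero, hence at a critical point
    S = 0, and F = 0 then forces x2^2 (w1^2 + x1) to be the real number m r^2 n
    ([J_relations]).  With e + i j = x2 w1 these relations read
      n om3 = 2 (al3 e - be3 j),   (e + i j)^2 = n (m r^2 - x2).
    They imply W^2 = |m r^2 - x1|^2 and (m (n + z1 z2) + W)^2 = l^2 n, which
    provides the radical sg, and
      a^2 - s1^2 = - r^2 al3^2 / n,   Phi(s1) = - 4 r^2 j^2 / n^2,
      b^2 - s2^2 =   r^2 be3^2 / n,   Phi(s2) =   4 r^2 e^2 / n^2,
    while the equations of motion give s1' = r^2 al3 j / (n sg) and
    s2' = - r^2 be3 e / (n sg): this is the separated system.

    _Elliptic solutions._  A separated equation reads s'^2 = P(s), with P a
    quartic having the four real roots c, - c, (l + 1) / (2 m) and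
    (l - 1) / (2 m).  If s' vanishes identically, s is constant.  Otherwise
    P(s) > 0 at some time t1, so s(t1) lies, on the projective line, in an open
    arc between two adjacent roots.  A real Moebius map carries these two roots
    to 1, -1 and the two others to 1/k, -1/k, and transports sn(nu (t - t0)) to
    a function E with E'^2 = P(E); nu and t0 are chosen so that E and s have the
    same value and derivative at t1 ([jacobi_sn_case]).  When roots collide, the
    same construction works with k = 0, with sn = tanh, or with cn = sech.  That
    s = E at all times is [mobius_solution]: the set of times where s = E,
    s' = E' and s'' = P'(s)/2 is closed, and it is open by uniqueness for the
    second order equation s'' = P'(s)/2.  At a turning point
    of E the value P'(E) is not zero; there s'' = P'(s)/2 is not zero either, so s
    cannot come to rest. *)

(** * Real functions on an open interval *)

Ltac nonzero := match goal with
  | |- _ * _ <> 0 => apply Rmult_integral_contrapositive_currified; nonzero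
  | |- _ / _ <> 0 => apply Rmult_integral_contrapositive_currified; nonzero
  | |- / _ <> 0 => apply Rinv_neq_0_compat; nonzero
  | |- _ ^ _ <> 0 => apply pow_nonzero; nonzero
  | _ => assumption || lra
  end.

Ltac positive := match goal with
  | |- 0 < _ * _ => apply Rmult_lt_0_compat; positive
  | |- 0 < _ ^ 2 => apply pow2_gt_0; nonzero
  | _ => assumption || lra
  end.

Ltac continuity_of_polynomial :=
  match goal with
  | |- continuous (fun x => @?f x + @?g x) _ =>
      apply (continuous_plus f g); continuity_of_polynomial
  | |- continuous (fun x => @?f x - @?g x) _ =>
      apply (continuous_minus f g); continuity_of_polynomial
  | |- continuous (fun x => @?f x * @?g x) _ =>
      apply (continuous_mult f g); continuity_of_polynomial
  | |- continuous (fun x => - @?f x) _ =>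
      apply (continuous_opp f); continuity_of_polynomial
  | |- continuous (fun _ => ?c) _ => apply continuous_const
  | _ => assumption
  end.

Lemma pow2_eq_cases x y : x ^ 2 = y ^ 2 -> x = y \/ x = - y.
Proof. intros E. apply Rsqr_eq. rewrite !Rsqr_pow2. exact E. Qed.

Lemma is_derive_eq (f : R -> R) (t d d' : R) :
  is_derive f t d -> d = d' -> is_derive f t d'.
Proof. intros Hf <-. exact Hf. Qed.

Lemma is_derive_sum_of_squares (f g : R -> R) t df dg :
  is_derive f t df -> is_derive g t dg ->
  is_derive (fun t => f t ^ 2 + g t ^ 2) t (2 * (f t * df + g t * dg)).
Proof.
  intros Hf Hg. auto_derive.
  { split; [eexists; exact Hf|split; [eexists; exact Hg|trivial]]. }
  replace (Derive (fun x => f x) t) with df by (symmetry; apply is_derive_unique, Hf).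
  replace (Derive (fun x => g x) t) with dg by (symmetry; apply is_derive_unique, Hg).
  ring.
Qed.

Lemma in_interval_locally lo hi t : in_interval lo hi t -> locally t (in_interval lo hi).
Proof.
  intros Ht. exact (open_and _ _ (open_Rbar_gt lo) (open_Rbar_lt hi) t Ht).
Qed.

Lemma in_interval_between lo hi t1 t2 t : in_interval lo hi t1 -> in_interval lo hi t2 ->
  Rmin t1 t2 <= t <= Rmax t1 t2 -> in_interval lo hi t.
Proof.
  unfold in_interval. intros [H1 H2] [H3 H4].
  destruct lo, hi; simpl in *; unfold Rmin, Rmax; destruct Rle_dec; intros; split;
    try tauto; lra.
Qed.

Lemma constant_of_zero_derivative lo hi (f : R -> R) t1 t2 :
  (forall t, in_interval lo hi t -> is_derive f t 0) ->
  in_interval lo hi t1 -> in_interval lo hi t2 -> f t1 = f t2.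
Proof.
  intros Hf H1 H2.
  destruct (MVT_gen f t1 t2 (fun _ => 0)) as [c [_ Hc]].
  - intros x Hx. apply Hf. apply (in_interval_between _ _ t1 t2); try assumption; lra.
  - intros x Hx. apply continuity_pt_filterlim. apply (ex_derive_continuous f). exists 0.
    apply Hf. apply (in_interval_between _ _ t1 t2); assumption.
  - lra.
Qed.

(** The indicator function of a set that is open and closed in the interval has
    zero derivative. *)
Lemma interval_connected lo hi (A : R -> Prop) t1 :
  (forall t, in_interval lo hi t -> A t -> locally t A) ->
  (forall t, in_interval lo hi t -> ~ A t -> locally t (fun u => ~ A u)) ->
  in_interval lo hi t1 -> A t1 -> forall t, in_interval lo hi t -> A t.
Proof.
  intros Ho Hc H1 HA t Ht.
  set (f := fun t => if excluded_middle_informative (A t) then 1 else 0).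
  assert (E : f t1 = f t).
  { apply (constant_of_zero_derivative lo hi); try assumption. intros u Hu.
    destruct (excluded_middle_informative (A u)) as [Hu'|Hu'].
    - apply (is_derive_ext_loc (fun _ => 1)); [|exact (is_derive_const 1 u)].
      generalize (Ho u Hu Hu'). apply filter_imp. intros v Hv. unfold f.
      destruct excluded_middle_informative; [reflexivity|contradiction].
    - apply (is_derive_ext_loc (fun _ => 0)); [|exact (is_derive_const 0 u)].
      generalize (Hc u Hu Hu'). apply filter_imp. intros v Hv. unfold f.
      destruct excluded_middle_informative; [contradiction|reflexivity]. }
  unfold f in E. destruct (excluded_middle_informative (A t1)); [|contradiction].
  destruct (excluded_middle_informative (A t)); [assumption|lra].
Qed.

Lemma continuous_nonzero (f : R -> R) (t : R) : continuous f t -> f t <> 0 ->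
  locally t (fun u => f u <> 0).
Proof. intros Hf Hn. exact (Hf _ (open_neq 0 (f t) Hn)). Qed.

Lemma derive_nonzero_punctured (f : R -> R) (t d : R) : is_derive f t d -> f t = 0 -> d <> 0 ->
  locally t (fun u => u <> t -> f u <> 0).
Proof.
  intros Hf H0 Hd. apply is_derive_Reals in Hf.
  destruct (Hf (Rabs d) (Rabs_pos_lt _ Hd)) as [e He].
  exists e. enough (E : forall u : R, Rabs (u - t) < e -> u <> t -> f u <> 0) by exact E.
  intros u Hu Hne Hfu.
  specialize (He (u - t)). rewrite H0 in He. replace (t + (u - t)) with u in He by ring.
  rewrite Hfu in He. replace ((0 - 0) / (u - t) - d) with (- d) in He by (field; lra).
  rewrite Rabs_Ropp in He. assert (Rabs d < Rabs d); [|lra]. apply He; [lra|exact Hu].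
Qed.

(** The function [g exp (- C (t - t0))] is nonincreasing and [g exp (C (t - t0))] is
    nondecreasing, so [g] is at most 0 on both sides of [t0]. *)
Lemma gronwall_zero (g dg : R -> R) (C t0 d : R) :
  (forall t, Rabs (t - t0) < d ->
     is_derive g t (dg t) /\ Rabs (dg t) <= C * g t /\ 0 <= g t) ->
  g t0 = 0 -> forall t, Rabs (t - t0) < d -> g t = 0.
Proof.
  intros Hg H0 t Ht.
  assert (Hd : forall (e : R) u, Rabs (u - t0) < d ->
    is_derive (fun u => g u * exp (e * (u - t0))) u
      ((dg u + e * g u) * exp (e * (u - t0)))).
  { intros e u Hu. pose proof (proj1 (Hg u Hu)) as Hgu. auto_derive.
    - eexists; exact Hgu.
    - replace (Derive (fun x => g x) u) with (dg u) by (symmetry; apply is_derive_unique,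
        Hgu). unfold Rminus; ring. }
  assert (Hb : forall u, Rmin t0 t <= u <= Rmax t0 t -> Rabs (u - t0) < d).
  { intros u. revert Ht. unfold Rmin, Rmax, Rabs.
    destruct Rle_dec; repeat destruct Rcase_abs; lra. }
  destruct (Hg t Ht) as [_ [_ Hp]].
  assert (HE : forall e, 0 < exp (e * (t - t0))) by (intros; apply exp_pos).
  assert (Hm : forall e, exists c, Rabs (c - t0) < d /\
    g t * exp (e * (t - t0)) = (dg c + e * g c) * exp (e * (c - t0)) * (t - t0)).
  { intros e.
    destruct (MVT_gen (fun u => g u * exp (e * (u - t0))) t0 t
                (fun u => (dg u + e * g u) * exp (e * (u - t0)))) as [c [Hc Hce]].
    - intros x Hx. apply Hd, Hb. lra.
    - intros x Hx. apply continuity_pt_filterlim.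
      apply (ex_derive_continuous (fun u => g u * exp (e * (u - t0)))). eexists.
      apply Hd, Hb, Hx.
    - exists c. split; [apply Hb, Hc|]. rewrite H0 in Hce. lra. }
  destruct (Rle_dec t0 t) as [Hle|Hle].
  - destruct (Hm (- C)) as [c [Hc E]]. destruct (Hg c Hc) as [_ [Hc2 _]].
    pose proof (exp_pos (- C * (c - t0))). specialize (HE (- C)).
    pose proof (Rle_abs (dg c)).
    assert (g t * exp (- C * (t - t0)) <= 0); [|nra].
    rewrite E. assert ((dg c + - C * g c) * exp (- C * (c - t0)) <= 0) by nra. nra.
  - destruct (Hm C) as [c [Hc E]]. destruct (Hg c Hc) as [_ [Hc2 _]].
    pose proof (exp_pos (C * (c - t0))). specialize (HE C).
    pose proof (Rle_abs (- dg c)) as H2. rewrite Rabs_Ropp in H2.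
    assert (g t * exp (C * (t - t0)) <= 0); [|nra].
    rewrite E. assert (0 <= (dg c + C * g c) * exp (C * (c - t0))) by nra. nra.
Qed.

(** Gronwall for the energy [(x - y)^2 + (x' - y')^2]. *)
Lemma second_order_unique (f x dx y dy : R -> R) (k t0 : R) :
  0 <= k ->
  locally t0 (fun t => is_derive x t (dx t) /\ is_derive dx t (f (x t))) ->
  locally t0 (fun t => is_derive y t (dy t) /\ is_derive dy t (f (y t))) ->
  locally t0 (fun t => Rabs (f (x t) - f (y t)) <= k * Rabs (x t - y t)) ->
  x t0 = y t0 -> dx t0 = dy t0 -> locally t0 (fun t => x t = y t).
Proof.
  intros Hk0 Hx Hy Hk E0 E1.
  destruct (filter_and _ _ (filter_and _ _ Hx Hy) Hk) as [d Hd].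
  exists d. intros t Ht.
  set (g := fun t => (x t - y t) ^ 2 + (dx t - dy t) ^ 2).
  assert (Hg : g t = 0).
  { apply (gronwall_zero g (fun t => 2 * ((x t - y t) * (dx t - dy t) + (dx t - dy t) *
      (f (x t) - f (y t)))) (1 + k) t0 d).
    - intros u Hu. destruct (Hd u Hu) as [[[h1 h2] [h3 h4]] h5].
      split; [|split].
      + apply (is_derive_sum_of_squares (fun t => x t - y t) (fun t => dx t - dy t)).
        * exact (is_derive_minus _ _ _ _ _ h1 h3).
        * exact (is_derive_minus _ _ _ _ _ h2 h4).
      + unfold g.
        clear -h5 Hk0. set (A := x u - y u) in *. set (B := dx u - dy u) in *.
        set (D := f (x u) - f (y u)) in *.
        rewrite Rabs_mult, (Rabs_pos_eq 2) by lra.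
        assert (Rabs (A * B + B * D) <= Rabs A * Rabs B + Rabs B * Rabs D) by
          (rewrite <- !Rabs_mult; apply Rabs_triang).
        rewrite <- (pow2_abs A), <- (pow2_abs B).
        revert H h5.
        generalize (Rabs_pos A) (Rabs_pos B) (Rabs_pos D) (Rabs (A * B + B * D)).
        generalize (Rabs A) (Rabs B) (Rabs D). intros A' B' D' hA hB hD z hz h5.
        pose proof (Rmult_le_compat_l _ _ _ hB h5) as h6.
        pose proof (Rmult_le_pos _ _ Hk0 (pow2_ge_0 (A' - B'))) as h7.
        pose proof (pow2_ge_0 (A' - B')). lra.
      + apply Rplus_le_le_0_compat; apply pow2_ge_0.
    - unfold g. rewrite E0, E1. ring.
    - exact Ht. }
  unfold g in Hg. pose proof (pow2_ge_0 (x t - y t)). pose proof (pow2_ge_0 (dx t - dy t)).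
  apply Rminus_diag_uniq, Rsqr_0_uniq. rewrite Rsqr_pow2. lra.
Qed.

(** By continuity [sg] keeps its sign near [t], so there it is [sqrt n] or
    [- sqrt n]. *)
Lemma is_derive_square_root (sg n : R -> R) (t dn : R) :
  continuous sg t -> locally t (fun x => sg x ^ 2 = n x) ->
  is_derive n t dn -> sg t <> 0 -> is_derive sg t (dn / (2 * sg t)).
Proof.
  intros Hc Hsq Hn Hnz.
  set (e := sg t / Rabs (sg t)).
  assert (Habs : Rabs (sg t) <> 0) by (apply Rabs_no_R0; exact Hnz).
  assert (He : e * e = 1).
  { unfold e. transitivity (Rsqr (sg t) / Rsqr (Rabs (sg t))); [unfold Rsqr; field;
      exact Habs|].
    rewrite <- Rsqr_abs. field. unfold Rsqr. nra. }
  assert (Hpos : locally t (fun x => 0 < e * sg x)).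
  { apply (continuous_scal_r e sg t Hc).
    apply (open_gt 0). unfold scal; simpl; unfold mult; simpl.
    unfold e. replace (sg t / Rabs (sg t) * sg t) with (Rsqr (sg t) / Rabs (sg t))
      by (unfold Rsqr; field; exact Habs).
    apply Rdiv_lt_0_compat; [apply Rsqr_pos_lt; exact Hnz|apply Rabs_pos_lt; exact Hnz]. }
  pose proof (locally_singleton _ _ Hsq) as Hsq0.
  pose proof (locally_singleton _ _ Hpos) as Hpos0. simpl in Hsq0, Hpos0.
  assert (Hsqrt : forall x, sg x ^ 2 = n x -> 0 < e * sg x -> e * sqrt (n x) = sg x).
  { intros x Hx Hp. rewrite <- Hx. replace (sg x ^ 2) with ((e * sg x)^2) by (simpl; nra).
    rewrite sqrt_pow2 by lra. transitivity ((e * e) * sg x); [ring|rewrite He; ring]. }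
  apply (is_derive_ext_loc (fun x => e * sqrt (n x))).
  { generalize (filter_and _ _ Hsq Hpos). apply filter_imp. intros x [H1 H2].
    apply Hsqrt; assumption. }
  assert (Hn0 : 0 < n t) by (rewrite <- Hsq0; nra).
  assert (Hs0 : sqrt (n t) = e * sg t).
  { pose proof (Hsqrt t Hsq0 Hpos0) as E. transitivity ((e*e) * sqrt (n t)); [rewrite He;
      ring|rewrite <- E; ring]. }
  auto_derive.
  { repeat split; [eexists; exact Hn|exact Hn0]. }
  replace (Derive (fun x => n x) t) with dn by (symmetry; apply is_derive_unique, Hn).
  rewrite Hs0.
  assert (e <> 0) by (intros E; rewrite E in He; lra).
  field; split; assumption.
Qed.

(** The class C^1 on an interval, used to obtain a continuous second derivative of
    the separated variables without computing it. *)
Section C1.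
Context (lo hi : Rbar).

Definition C1_on (f : R -> R) : Prop :=
  exists f' : R -> R, forall t, in_interval lo hi t ->
    is_derive f t (f' t) /\ continuous f' t.

Lemma C1_continuous f t : in_interval lo hi t -> C1_on f -> continuous f t.
Proof.
  intros Ht [f' Hf]. apply (ex_derive_continuous f). eexists. apply Hf, Ht.
Qed.

Lemma C1_const c : C1_on (fun _ => c).
Proof.
  exists (fun _ => 0). intros t _.
  split; [exact (is_derive_const c t) | apply continuous_const].
Qed.

Lemma C1_plus f g : C1_on f -> C1_on g -> C1_on (fun t => f t + g t).
Proof.
  intros [f' Hf] [g' Hg]. exists (fun t => f' t + g' t). intros t Ht.
  split.
  - apply (is_derive_plus f g); [apply Hf|apply Hg]; exact Ht.
  - apply (continuous_plus f' g'); [apply Hf|apply Hg]; exact Ht.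
Qed.

Lemma C1_mult f g : C1_on f -> C1_on g -> C1_on (fun t => f t * g t).
Proof.
  intros Cf Cg. pose proof Cf as [f' Hf]; pose proof Cg as [g' Hg].
  exists (fun t => f' t * g t + f t * g' t). intros t Ht.
  split.
  - apply (is_derive_mult f g); [apply Hf|apply Hg|intros; apply Rmult_comm]; exact Ht.
  - apply (continuous_plus (fun t => f' t * g t) (fun t => f t * g' t)).
    + apply (continuous_mult f' g); [apply Hf, Ht|apply C1_continuous; assumption].
    + apply (continuous_mult f g'); [apply C1_continuous; assumption|apply Hg, Ht].
Qed.

Lemma C1_inv f : C1_on f -> (forall t, in_interval lo hi t -> f t <> 0) ->
  C1_on (fun t => / f t).
Proof.
  intros Cf H0. pose proof Cf as [f' Hf].
  exists (fun t => - f' t / f t ^ 2). intros t Ht.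
  assert (Cf0 := C1_continuous _ _ Ht Cf).
  split.
  - apply is_derive_inv; [apply Hf|apply H0]; exact Ht.
  - apply (continuous_mult (fun t => - f' t) (fun t => / (f t ^ 2))).
    + apply (continuous_opp f'). apply Hf, Ht.
    + apply (continuous_comp (fun t => f t ^ 2) Rinv).
      * apply (continuous_comp f (fun y => y ^ 2)); [exact Cf0|].
        apply (ex_derive_continuous (fun y : R => y ^ 2)); auto_derive; trivial.
      * apply continuous_Rinv. apply pow_nonzero, H0, Ht.
Qed.

Lemma C1_minus f g : C1_on f -> C1_on g -> C1_on (fun t => f t - g t).
Proof.
  intros [f' Hf] [g' Hg]. exists (fun t => f' t - g' t). intros t Ht.
  split.
  - apply (is_derive_minus f g); [apply Hf|apply Hg]; exact Ht.
  - apply (continuous_minus f' g'); [apply Hf|apply Hg]; exact Ht.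
Qed.
End C1.

Ltac C1_tac := match goal with
  | |- C1_on _ _ (fun _ => ?c) => apply C1_const
  | |- C1_on _ _ (fun t => @?f t + @?g t) => apply (C1_plus _ _ f g); C1_tac
  | |- C1_on _ _ (fun t => @?f t - @?g t) => apply (C1_minus _ _ f g); C1_tac
  | |- C1_on _ _ (fun t => @?f t * @?g t) => apply (C1_mult _ _ f g); C1_tac
  | |- C1_on _ _ (fun t => / @?f t) => apply (C1_inv _ _ f); [C1_tac|]
  | _ => assumption
 end.

(** * The invariant relations on the critical set *)

Lemma is_derive_fst_comp (U V : NormedModule R_AbsRing) (f : R -> U * V) t l :
  is_derive f t l -> is_derive (fun x => fst (f x)) t (fst l).
Proof.
  intros Hf.
  eapply filterdiff_ext_lin.
  - apply (filterdiff_comp' f (fun z => fst z)); [exact Hf|].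
    apply filterdiff_linear, is_linear_fst.
  - simpl; intros y; reflexivity.
Qed.

Lemma is_derive_snd_comp (U V : NormedModule R_AbsRing) (f : R -> U * V) t l :
  is_derive f t l -> is_derive (fun x => snd (f x)) t (snd l).
Proof.
  intros Hf.
  eapply filterdiff_ext_lin.
  - apply (filterdiff_comp' f (fun z => snd z)); [exact Hf|].
    apply filterdiff_linear, is_linear_snd.
  - simpl; intros y; reflexivity.
Qed.

Definition w1_norm2 (q : state) : R := c1 (om q) ^ 2 + c2 (om q) ^ 2.
Definition re_x1 (q : state) : R := c1 (al q) - c2 (be q).
Definition im_x1 (q : state) : R := c2 (al q) + c1 (be q).
Definition re_x2w1 (q : state) : R :=
  re_x1 q * c1 (om q) + im_x1 q * c2 (om q).
Definition im_x2w1 (q : state) : R :=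
  re_x1 q * c2 (om q) - im_x1 q * c1 (om q).

Lemma xx_re_im q : xx q = re_x1 q ^ 2 + im_x1 q ^ 2.
Proof. unfold xx, x2, x1, re_x1, im_x1, Cconj, Cmult, Re; simpl; ring. Qed.

Lemma zz_re_im q : zz q = c3 (al q) ^ 2 + c3 (be q) ^ 2.
Proof. unfold zz, z2, z1, Cconj, Cmult, Re; simpl; ring. Qed.

Lemma xsum_re q : xsum q = 2 * re_x1 q.
Proof. unfold xsum, x2, x1, re_x1, Cconj, Cplus, Re; simpl; ring. Qed.

Ltac coordinates q :=
  destruct q as [[[[o1 o2] o3] [[al1 al2] al3]] [[be1 be2] be3]];
  unfold F, G, H, K, w1_norm2, om_alpha, om_beta, om_gamma, momentum,
    phase_space, re_x2w1, im_x2w1, re_x1, im_x1, dot, cross,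
    c1, c2, c3, om, al, be in *;
  cbn [fst snd] in *.

(* Closes an identity that holds modulo Hab, the orthogonality of alpha and beta:
   the difference of both sides is d, a multiple of their scalar product. *)
Ltac modulo_orthogonality Hab d :=
  match goal with |- ?lhs = ?rhs =>
    let E := fresh in
    assert (E : lhs - rhs = d) by field; rewrite Hab in E; lra
  end.

Lemma rc_pow2 a b : 0 < b < a -> rc a b ^ 2 = a ^ 2 - b ^ 2.
Proof. intros h. apply pow2_sqrt. nra. Qed.

Lemma rc_pow4 a b : 0 < b < a -> rc a b ^ 4 = (a ^ 2 - b ^ 2) ^ 2.
Proof. intros h. rewrite <- (rc_pow2 _ _ h). ring. Qed.

Lemma pc_pow2 a b : pc a b ^ 2 = a ^ 2 + b ^ 2.
Proof. apply pow2_sqrt. nra. Qed.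

Definition M_numerator (a b : R) (q : state) : R :=
  2 * G a b q - (a ^ 2 + b ^ 2) * H q.

(** [2 Re (x2 z1 w1) - x1 x2 om3]: the only combination through which [om3] enters
    [F]; its vanishing is the first invariant relation. *)
Definition om3_defect (q : state) : R :=
  2 * (c3 (al q) * re_x2w1 q - c3 (be q) * im_x2w1 q) - xx q * c3 (om q).

(** With [xi = alpha + i beta] and [y2 = xi_1 - i xi_2] one has
    [x1 y2 + z1^2 = xi . xi = a^2 - b^2], which removes [y2] from [2 G - p^2 H]
    and lets the terms in [om3] and [z1] complete a square. *)
Lemma M_numerator_identity a b q : phase_space a b q ->
  2 * xx q * M_numerator a b q =
  2 * (a ^ 2 - b ^ 2) * (re_x2w1 q ^ 2 - im_x2w1 q ^ 2 + xx q * re_x1 q)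
  - om3_defect q ^ 2.
Proof.
  unfold M_numerator, om3_defect; rewrite xx_re_im; coordinates q.
  intros [Ha [Hb Hab]]. rewrite <- Ha, <- Hb.
  modulo_orthogonality Hab ((al1 * be1 + al2 * be2 + al3 * be3) *
    (- 8 * ((al1 - be2) * o1 + (al2 + be1) * o2) *
     ((al1 - be2) * o2 - (al2 + be1) * o1))).
Qed.

(** [K = |w1^2 + x1|^2] and [x2^2 (w1^2 + x1) = (x2 w1)^2 + x1 x2 x2]. *)
Lemma K_identity q :
  xx q ^ 2 * K q =
  (re_x2w1 q ^ 2 - im_x2w1 q ^ 2 + xx q * re_x1 q) ^ 2 +
  (2 * re_x2w1 q * im_x2w1 q - xx q * im_x1 q) ^ 2.
Proof. rewrite xx_re_im; coordinates q; ring. Qed.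

Lemma w1_norm2_x2w1 q : xx q * w1_norm2 q = re_x2w1 q ^ 2 + im_x2w1 q ^ 2.
Proof. rewrite xx_re_im; coordinates q; ring. Qed.

(** With [y2] as in [M_numerator_identity]: [2 p^2 = x1 x2 + y1 y2 + 2 z1 z2] and
    [alpha_1 + beta_2 = Re y2], where [x1 y2 = a^2 - b^2 - z1^2] after
    multiplication by [x1]. *)
Lemma geometric_relations a b q : phase_space a b q ->
  xx q * (2 * (a ^ 2 + b ^ 2)) = xx q * (xx q + 2 * zz q)
    + (a ^ 2 - b ^ 2 - (c3 (al q) ^ 2 - c3 (be q) ^ 2)) ^ 2
    + 4 * c3 (al q) ^ 2 * c3 (be q) ^ 2 /\
  xx q * (c1 (al q) + c2 (be q)) = re_x1 q * (a ^ 2 - b ^ 2)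
    - (re_x1 q * (c3 (al q) ^ 2 - c3 (be q) ^ 2)
       + 2 * im_x1 q * c3 (al q) * c3 (be q)).
Proof.
  rewrite xx_re_im, zz_re_im; coordinates q.
  intros [Ha [Hb Hab]]. rewrite <- Ha, <- Hb.
  split.
  - modulo_orthogonality Hab ((al1 * be1 + al2 * be2 + al3 * be3) *
      (4 * (al1 * be1 + al2 * be2 - al3 * be3))).
  - modulo_orthogonality Hab ((al1 * be1 + al2 * be2 + al3 * be3) *
      (2 * (al2 + be1))).
Qed.

Lemma F_derivative_om3 a b q : phase_space a b q ->
  is_derive
    (fun t => F a b (c1 (om q), c2 (om q), c3 (om q) + t, al q, be q)) 0
    (2 * M_numerator a b q * om3_defect q).
Proof.
  intros Hp. unfold M_numerator, om3_defect; rewrite xx_re_im.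
  unfold F. rewrite pc_pow2. coordinates q.
  destruct Hp as [Ha [Hb Hab]].
  auto_derive; [trivial|].
  change (a * (a * 1)) with (a ^ 2). change (b * (b * 1)) with (b ^ 2).
  rewrite <- Ha, <- Hb. field.
Qed.

Lemma critical_om3 a b q : N a b q ->
  is_derive
    (fun t => F a b (c1 (om q), c2 (om q), c3 (om q) + t, al q, be q)) 0 0.
Proof.
  intros [Hp [_ Hc]].
  apply (Hc (fun t => (c1 (om q), c2 (om q), c3 (om q) + t, al q, be q))).
  - intros t; exact Hp.
  - rewrite Rplus_0_r. destruct q as [[[[? ?] ?] ?] ?]; reflexivity.
  - eexists.
    set (e3 := ((0, 0, 1), (0, 0, 0), (0, 0, 0)) : state).
    set (q0 := (c1 (om q), c2 (om q), c3 (om q), al q, be q) : state).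
    apply (is_derive_ext (fun t => plus q0 (scal t e3))).
    { intros t. destruct q as [[[[o1 o2] o3] [[a1 a2] a3]] [[b1 b2] b3]].
      cbv -[Rplus Rmult]. repeat f_equal; ring. }
    apply (is_derive_plus (fun _ => q0) (fun t => scal t e3) 0 zero).
    apply is_derive_const.
    apply (is_derive_scal_l (fun t => t) 0 one e3). apply is_derive_id.
Qed.

(** As [m] is not zero, [2 G - p^2 H] does not vanish, so the derivative of [F] in
    [om3] kills [om3_defect]; then [F = 0] compares the real part of
    [x2^2 (w1^2 + x1)] with its modulus, and its imaginary part vanishes. *)
Lemma J_relations a b m l q :
  0 < b < a -> m <> 0 -> xx q <> 0 -> J a b m l q ->
  xx q * c3 (om q) =
    2 * (c3 (al q) * re_x2w1 q - c3 (be q) * im_x2w1 q) /\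
  re_x2w1 q ^ 2 - im_x2w1 q ^ 2 = xx q * (m * (a ^ 2 - b ^ 2) - re_x1 q) /\
  2 * re_x2w1 q * im_x2w1 q = xx q * im_x1 q /\
  l ^ 2 = 2 * (a ^ 2 + b ^ 2) * m ^ 2 + 2 * H q * m + 1.
Proof.
  intros h hm hn [HN [HM [HL0 HL]]].
  assert (Hr : a ^ 2 - b ^ 2 <> 0) by nra.
  pose proof (critical_om3 _ _ _ HN) as Hc.
  destruct HN as [Hp [HF _]].
  assert (Hf : M_numerator a b q = m * (a ^ 2 - b ^ 2) ^ 2).
  { unfold M in HM. rewrite rc_pow4, pc_pow2 in HM by assumption.
    rewrite <- HM. unfold M_numerator. field. exact Hr. }
  pose proof (is_derive_unique _ _ _ Hc) as E0.
  rewrite (is_derive_unique _ _ _ (F_derivative_om3 a b q Hp)), Hf in E0.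
  assert (HS : om3_defect q = 0).
  { apply Rmult_integral in E0. destruct E0 as [E0|E0]; [exfalso|exact E0].
    assert (2 * (m * (a ^ 2 - b ^ 2) ^ 2) <> 0) by nonzero. contradiction. }
  pose proof (M_numerator_identity a b q Hp) as HI. rewrite HS, Hf in HI.
  pose proof (K_identity q) as HK.
  unfold F in HF. rewrite pc_pow2, rc_pow4 in HF by assumption.
  fold (M_numerator a b q) in HF. rewrite Hf in HF.
  set (A := re_x2w1 q ^ 2 - im_x2w1 q ^ 2 + xx q * re_x1 q) in *.
  set (B := 2 * re_x2w1 q * im_x2w1 q - xx q * im_x1 q) in *.
  assert (HA : A = xx q * (m * (a ^ 2 - b ^ 2))).
  { apply (Rmult_eq_reg_l (2 * (a ^ 2 - b ^ 2))); lra. }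
  assert (HKv : K q = m ^ 2 * (a ^ 2 - b ^ 2) ^ 2).
  { apply (Rmult_eq_reg_l ((a ^ 2 - b ^ 2) ^ 2)); [lra|nonzero]. }
  rewrite HKv, HA in HK.
  assert (HB : B = 0).
  { apply Rsqr_0_uniq. unfold Rsqr. lra. }
  repeat split.
  - unfold om3_defect in HS. lra.
  - unfold A in HA. lra.
  - unfold B in HB. lra.
  - rewrite <- HL. unfold L. rewrite pow2_sqrt by exact HL0.
    unfold L_radicand. rewrite pc_pow2, HM. ring.
Qed.

(** * The separated variables at a point of the integral manifold *)

Section OnIntegralManifold.
Context (a b m l : R) (q : state) (h : 0 < b < a) (hm : m <> 0)
  (hn : xx q <> 0) (hJ : J a b m l q).

Lemma re_im_x2w1_squares :
  2 * re_x2w1 q ^ 2 =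
    xx q * (w1_norm2 q + m * (a ^ 2 - b ^ 2) - re_x1 q) /\
  2 * im_x2w1 q ^ 2 =
    xx q * (w1_norm2 q - m * (a ^ 2 - b ^ 2) + re_x1 q).
Proof.
  destruct (J_relations a b m l q h hm hn hJ) as [_ [H1 _]].
  pose proof (w1_norm2_x2w1 q). lra.
Qed.

(** The modulus of the relation [(x2 w1)^2 = x1 x2 (m r^2 - x2)]. *)
Lemma w1_norm2_square :
  w1_norm2 q ^ 2 = m ^ 2 * rc a b ^ 4 - m * rc a b ^ 2 * xsum q + xx q.
Proof.
  destruct (J_relations a b m l q h hm hn hJ) as [_ [H1 [H2 _]]].
  pose proof (w1_norm2_x2w1 q) as H3.
  rewrite rc_pow4, rc_pow2, xsum_re by assumption.
  apply (Rmult_eq_reg_l (xx q ^ 2)); [|nonzero].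
  transitivity ((re_x2w1 q ^ 2 - im_x2w1 q ^ 2) ^ 2
                + (2 * re_x2w1 q * im_x2w1 q) ^ 2).
  - transitivity ((xx q * w1_norm2 q) ^ 2); [ring|rewrite H3; ring].
  - rewrite H1, H2. rewrite xx_re_im. ring.
Qed.

Lemma w1_norm2_sqrt :
  sqrt (m ^ 2 * rc a b ^ 4 - m * rc a b ^ 2 * xsum q + xx q) = w1_norm2 q.
Proof.
  rewrite <- w1_norm2_square. apply sqrt_pow2. unfold w1_norm2. nra.
Qed.

(** The integral [L = l] after elimination of [om3] and of [alpha_1 + beta_2]; it
    makes the sign rule for the radical of [x1 x2] satisfiable. *)
Lemma radical_square :
  (m * (xx q + zz q) + w1_norm2 q) ^ 2 = l ^ 2 * xx q.
Proof.
  destruct (J_relations a b m l q h hm hn hJ) as [H0 [H1 [H2 H4]]].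
  destruct re_im_x2w1_squares as [He Hi].
  pose proof w1_norm2_square as HW.
  rewrite rc_pow4, rc_pow2, xsum_re in HW by assumption.
  destruct (geometric_relations a b q) as [Hg1 Hg2]. { apply hJ. }
  set (r := a ^ 2 - b ^ 2) in *.
  set (A := c3 (al q)) in *. set (B := c3 (be q)) in *.
  assert (Ho : xx q * c3 (om q) ^ 2 =
      2 * A ^ 2 * (w1_norm2 q + m * r - re_x1 q)
      + 2 * B ^ 2 * (w1_norm2 q - m * r + re_x1 q) - 4 * A * B * im_x1 q).
  { apply (Rmult_eq_reg_l (xx q)); [|exact hn].
    transitivity ((xx q * c3 (om q)) ^ 2); [ring|].
    rewrite H0.
    transitivity (2 * A ^ 2 * (2 * re_x2w1 q ^ 2)
      + 2 * B ^ 2 * (2 * im_x2w1 q ^ 2)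
      - 4 * A * B * (2 * re_x2w1 q * im_x2w1 q)); [ring|].
    rewrite He, Hi, H2. ring. }
  assert (HH : 2 * H q =
      2 * w1_norm2 q + c3 (om q) ^ 2 - 2 * (c1 (al q) + c2 (be q))).
  { unfold H, w1_norm2. field. }
  rewrite H4, HH.
  transitivity (m ^ 2 * (xx q * (2 * (a ^ 2 + b ^ 2)))
    + m * (2 * xx q * w1_norm2 q + xx q * c3 (om q) ^ 2
           - 2 * (xx q * (c1 (al q) + c2 (be q)))) + xx q); [|ring].
  rewrite Hg1, Hg2, Ho.
  transitivity (m ^ 2 * (xx q + zz q) ^ 2
    + 2 * m * (xx q + zz q) * w1_norm2 q + w1_norm2 q ^ 2); [ring|].
  rewrite HW, zz_re_im. fold A B. ring.
Qed.

Context (sg : R) (hsg : sg ^ 2 = xx q)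
  (hs : m * (xx q + zz q) - l * sg
        + sqrt (m ^ 2 * rc a b ^ 4 - m * rc a b ^ 2 * xsum q + xx q) = 0).

Lemma radical_neq0 : sg <> 0.
Proof. intros E; apply hn; rewrite <- hsg, E; ring. Qed.

(** Taking [rho = r^2] gives [s1] and [c = a]; taking [rho = - r^2] gives [s2] and
    [c = b]. *)
Lemma root_gap c rho :
  rho ^ 2 = (a ^ 2 - b ^ 2) ^ 2 -> 2 * c ^ 2 = a ^ 2 + b ^ 2 + rho ->
  c ^ 2 - ((xx q + zz q + rho) / (2 * sg)) ^ 2 =
  - ((a ^ 2 - b ^ 2 + rho) * c3 (al q) ^ 2
     + (rho - (a ^ 2 - b ^ 2)) * c3 (be q) ^ 2) / (2 * xx q).
Proof.
  intros hr hc. pose proof radical_neq0 as h0.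
  destruct (geometric_relations a b q) as [Hg1 _]. { apply hJ. }
  apply (Rmult_eq_reg_l (4 * xx q)); [|nonzero].
  transitivity (2 * (xx q * (2 * c ^ 2)) - (xx q + zz q + rho) ^ 2).
  { rewrite <- hsg. field. exact h0. }
  rewrite hc.
  transitivity (xx q * (2 * (a ^ 2 + b ^ 2)) + 2 * xx q * rho
                - (xx q + zz q + rho) ^ 2); [ring|].
  rewrite Hg1, zz_re_im.
  match goal with |- ?lhs = ?rhs =>
    assert (E : lhs - rhs = (a ^ 2 - b ^ 2) ^ 2 - rho ^ 2)
      by (field; exact hn); lra
  end.
Qed.

(** The sign rule for [sg] turns [2 m s - l] into [(m rho - |w1|^2) / sg]. *)
Lemma Phi_separated rho :
  rho ^ 2 = (a ^ 2 - b ^ 2) ^ 2 ->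
  Phi m l ((xx q + zz q + rho) / (2 * sg)) =
  2 * (m * rho ^ 2 - rho * w1_norm2 q - (a ^ 2 - b ^ 2) * re_x1 q) / xx q.
Proof.
  intros hr. pose proof radical_neq0 as h0.
  pose proof hs as hs'. rewrite w1_norm2_sqrt in hs'.
  pose proof w1_norm2_square as HW.
  rewrite rc_pow4, rc_pow2, xsum_re in HW by assumption.
  transitivity (((2 * m * ((xx q + zz q + rho) / (2 * sg)) - l) ^ 2 - 1) / m).
  { unfold Phi. field. split; assumption. }
  replace (2 * m * ((xx q + zz q + rho) / (2 * sg)) - l)
    with ((m * rho - w1_norm2 q) / sg).
  2: { apply (Rmult_eq_reg_l sg); [|exact h0].
       field_simplify; try exact h0. lra. }
  transitivity ((m ^ 2 * rho ^ 2 - 2 * m * rho * w1_norm2 q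
                 + w1_norm2 q ^ 2 - xx q) / xx q / m).
  { rewrite <- hsg. field. split; assumption. }
  rewrite HW, hr. field. split; assumption.
Qed.

Lemma s1_gap :
  a ^ 2 - s1 a b q sg ^ 2 = - (a ^ 2 - b ^ 2) * c3 (al q) ^ 2 / xx q.
Proof.
  unfold s1. rewrite rc_pow2 by assumption.
  rewrite root_gap; [field; exact hn|reflexivity|lra].
Qed.

Lemma s2_gap :
  b ^ 2 - s2 a b q sg ^ 2 = (a ^ 2 - b ^ 2) * c3 (be q) ^ 2 / xx q.
Proof.
  unfold s2, Rminus at 2. rewrite rc_pow2 by assumption.
  rewrite root_gap; [field; exact hn|ring|lra].
Qed.

Lemma Phi_s1 :
  Phi m l (s1 a b q sg) = - 4 * (a ^ 2 - b ^ 2) * im_x2w1 q ^ 2 / xx q ^ 2.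
Proof.
  unfold s1. rewrite rc_pow2 by assumption. rewrite Phi_separated by reflexivity.
  replace (- 4 * (a ^ 2 - b ^ 2) * im_x2w1 q ^ 2)
    with (- 2 * (a ^ 2 - b ^ 2) * (2 * im_x2w1 q ^ 2)) by ring.
  rewrite (proj2 re_im_x2w1_squares). field. exact hn.
Qed.

Lemma Phi_s2 :
  Phi m l (s2 a b q sg) = 4 * (a ^ 2 - b ^ 2) * re_x2w1 q ^ 2 / xx q ^ 2.
Proof.
  unfold s2, Rminus at 1. rewrite rc_pow2 by assumption.
  rewrite Phi_separated by ring.
  replace (4 * (a ^ 2 - b ^ 2) * re_x2w1 q ^ 2)
    with (2 * (a ^ 2 - b ^ 2) * (2 * re_x2w1 q ^ 2)) by ring.
  rewrite (proj1 re_im_x2w1_squares). field. exact hn.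
Qed.
End OnIntegralManifold.

(** * The separated variables along a motion *)

Lemma motion_components (q : R -> state) t :
  is_derive q t (euler_poisson (q t)) ->
  is_derive (fun t => c1 (om (q t))) t
    ((c2 (om (q t)) * c3 (om (q t)) + c3 (be (q t))) / 2) /\
  is_derive (fun t => c2 (om (q t))) t
    ((- (c1 (om (q t)) * c3 (om (q t))) - c3 (al (q t))) / 2) /\
  is_derive (fun t => c3 (om (q t))) t (c2 (al (q t)) - c1 (be (q t))) /\
  is_derive (fun t => c1 (al (q t))) t (c1 (cross (al (q t)) (om (q t)))) /\
  is_derive (fun t => c2 (al (q t))) t (c2 (cross (al (q t)) (om (q t)))) /\
  is_derive (fun t => c3 (al (q t))) t (c3 (cross (al (q t)) (om (q t)))) /\
  is_derive (fun t => c1 (be (q t))) t (c1 (cross (be (q t)) (om (q t)))) /\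
  is_derive (fun t => c2 (be (q t))) t (c2 (cross (be (q t)) (om (q t)))) /\
  is_derive (fun t => c3 (be (q t))) t (c3 (cross (be (q t)) (om (q t)))).
Proof.
  intros Hq.
  pose proof (is_derive_fst_comp _ _ _ _ _ Hq) as Hoa.
  pose proof (is_derive_fst_comp _ _ _ _ _ Hoa) as Ho.
  pose proof (is_derive_snd_comp _ _ _ _ _ Hoa) as Ha.
  pose proof (is_derive_snd_comp _ _ _ _ _ Hq) as Hb.
  refine (conj _ (conj _ (conj _ (conj _ (conj _ (conj _ (conj _ (conj _ _)))))))).
  - exact (is_derive_fst_comp _ _ _ _ _ (is_derive_fst_comp _ _ _ _ _ Ho)).
  - exact (is_derive_snd_comp _ _ _ _ _ (is_derive_fst_comp _ _ _ _ _ Ho)).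
  - exact (is_derive_snd_comp _ _ _ _ _ Ho).
  - exact (is_derive_fst_comp _ _ _ _ _ (is_derive_fst_comp _ _ _ _ _ Ha)).
  - exact (is_derive_snd_comp _ _ _ _ _ (is_derive_fst_comp _ _ _ _ _ Ha)).
  - exact (is_derive_snd_comp _ _ _ _ _ Ha).
  - exact (is_derive_fst_comp _ _ _ _ _ (is_derive_fst_comp _ _ _ _ _ Hb)).
  - exact (is_derive_snd_comp _ _ _ _ _ (is_derive_fst_comp _ _ _ _ _ Hb)).
  - exact (is_derive_snd_comp _ _ _ _ _ Hb).
Qed.

Lemma components_C1 lo hi (q : R -> state) : motion_on lo hi q ->
  (C1_on lo hi (fun t => c1 (om (q t))) /\
   C1_on lo hi (fun t => c2 (om (q t)))) /\
  (C1_on lo hi (fun t => c1 (al (q t))) /\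
   C1_on lo hi (fun t => c2 (al (q t))) /\
   C1_on lo hi (fun t => c3 (al (q t)))) /\
  (C1_on lo hi (fun t => c1 (be (q t))) /\
   C1_on lo hi (fun t => c2 (be (q t))) /\
   C1_on lo hi (fun t => c3 (be (q t)))).
Proof.
  intros Hq.
  assert (HD := fun t Ht => motion_components q t (Hq t Ht)).
  assert (HC : forall t, in_interval lo hi t ->
     continuous (fun t => c1 (om (q t))) t /\
     continuous (fun t => c2 (om (q t))) t /\
     continuous (fun t => c3 (om (q t))) t /\
     continuous (fun t => c1 (al (q t))) t /\
     continuous (fun t => c2 (al (q t))) t /\
     continuous (fun t => c3 (al (q t))) t /\
     continuous (fun t => c1 (be (q t))) t /\
     continuous (fun t => c2 (be (q t))) t /\
     continuous (fun t => c3 (be (q t))) t).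
  { intros t Ht. destruct (HD t Ht) as (h1&h2&h3&h4&h5&h6&h7&h8&h9).
    repeat split; refine (ex_derive_continuous _ _ (ex_intro _ _ _)); eassumption. }
  refine (conj (conj _ _) (conj (conj _ (conj _ _)) (conj _ (conj _ _)))).
  1: exists (fun t => (c2 (om (q t)) * c3 (om (q t)) + c3 (be (q t))) / 2).
  2: exists (fun t => (- (c1 (om (q t)) * c3 (om (q t))) - c3 (al (q t))) / 2).
  3: exists (fun t => c1 (cross (al (q t)) (om (q t)))).
  4: exists (fun t => c2 (cross (al (q t)) (om (q t)))).
  5: exists (fun t => c3 (cross (al (q t)) (om (q t)))).
  6: exists (fun t => c1 (cross (be (q t)) (om (q t)))).
  7: exists (fun t => c2 (cross (be (q t)) (om (q t)))).
  8: exists (fun t => c3 (cross (be (q t)) (om (q t)))).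
  all: intros t Ht; split;
    [ destruct (HD t Ht) as (h1&h2&h3&h4&h5&h6&h7&h8&h9); assumption
    | destruct (HC t Ht) as (h1&h2&h3&h4&h5&h6&h7&h8&h9);
      unfold cross, Rdiv, Rminus;
      cbv beta iota delta [c1 c2 c3] in h1, h2, h3, h4, h5, h6, h7, h8, h9 |- *;
      cbn [fst snd] in *;
      continuity_of_polynomial ].
Qed.

Definition xx_dot (q : state) : R :=
  - 2 * (c3 (al q) * im_x2w1 q + c3 (be q) * re_x2w1 q).
Definition zz_dot (q : state) : R :=
  2 * (c3 (al q) * c3 (cross (al q) (om q)) + c3 (be q) * c3 (cross (be q) (om q))).

Lemma xx_derive (q : R -> state) t : is_derive q t (euler_poisson (q t)) ->
  is_derive (fun t => xx (q t)) t (xx_dot (q t)).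
Proof.
  intros Hq. destruct (motion_components q t Hq) as (h1&h2&h3&h4&h5&h6&h7&h8&h9).
  apply (is_derive_ext (fun t => re_x1 (q t) ^ 2 + im_x1 (q t) ^ 2)).
  { intros s. rewrite xx_re_im. reflexivity. }
  eapply is_derive_eq.
  - apply (is_derive_sum_of_squares (fun t => re_x1 (q t)) (fun t => im_x1 (q t))).
    + exact (is_derive_minus _ _ _ _ _ h4 h8).
    + exact (is_derive_plus _ _ _ _ _ h5 h7).
  - unfold minus, plus, opp; simpl.
    unfold xx_dot, im_x2w1, re_x2w1, re_x1, im_x1, cross, c1, c2, c3; cbn [fst snd].
    ring.
Qed.

Lemma zz_derive (q : R -> state) t : is_derive q t (euler_poisson (q t)) ->
  is_derive (fun t => zz (q t)) t (zz_dot (q t)).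
Proof.
  intros Hq. destruct (motion_components q t Hq) as (h1&h2&h3&h4&h5&h6&h7&h8&h9).
  apply (is_derive_ext (fun t => c3 (al (q t)) ^ 2 + c3 (be (q t)) ^ 2)).
  { intros s. rewrite zz_re_im. reflexivity. }
  exact (is_derive_sum_of_squares _ _ _ _ _ h6 h9).
Qed.

Lemma is_derive_half_quotient (n z sg : R -> R) (rho t dn dz dsg : R) :
  is_derive n t dn -> is_derive z t dz -> is_derive sg t dsg -> sg t <> 0 ->
  is_derive (fun t => (n t + z t + rho) / (2 * sg t)) t
    ((dn + dz) / (2 * sg t) - (n t + z t + rho) * dsg / (2 * sg t ^ 2)).
Proof.
  intros Hn Hz Hs H0. auto_derive.
  { repeat split; try (eexists; eassumption). lra. }
  replace (Derive (fun x => n x) t) with dn by (symmetry; apply is_derive_unique, Hn).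
  replace (Derive (fun x => z x) t) with dz by (symmetry; apply is_derive_unique, Hz).
  replace (Derive (fun x => sg x) t) with dsg by (symmetry; apply is_derive_unique, Hs).
  field. exact H0.
Qed.

(** The numerator of the derivative of [(xx + zz + rho) / (2 sqrt xx)]. *)
Lemma separated_dot_numerator a b q rho : phase_space a b q ->
  2 * xx q * (xx_dot q + zz_dot q) - (xx q + zz q + rho) * xx_dot q =
  2 * ((a ^ 2 - b ^ 2 + rho) * c3 (al q) * im_x2w1 q
       + (rho - (a ^ 2 - b ^ 2)) * c3 (be q) * re_x2w1 q).
Proof.
  unfold xx_dot, zz_dot. rewrite xx_re_im, zz_re_im. coordinates q.
  intros [Ha [Hb Hab]]. rewrite <- Ha, <- Hb.
  modulo_orthogonality Hab ((al1 * be1 + al2 * be2 + al3 * be3) *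
    (4 * (al3 * ((al1 - be2) * o1 + (al2 + be1) * o2)
          + be3 * ((al1 - be2) * o2 - (al2 + be1) * o1)))).
Qed.

Section Reduction.
Context (a b m l : R) (h : 0 < b < a) (hm : m <> 0) (lo hi : Rbar)
  (q : R -> state) (Hq : motion_on lo hi q)
  (HJ : forall t, in_interval lo hi t -> J a b m l (q t))
  (Hx : forall t, in_interval lo hi t -> xx (q t) <> 0).

(** By [radical_square] the sign rule determines the radical when [l] is not zero,
    and is satisfied by both square roots when [l = 0]. *)
Lemma radical_exists : exists sg, radical_along a b m l lo hi q sg.
Proof.
  destruct (components_C1 lo hi q Hq) as ((Co1&Co2)&_).
  assert (Hc : forall t, in_interval lo hi t ->
    continuous (fun t => xx (q t)) t /\ continuous (fun t => zz (q t)) t /\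
    continuous (fun t => w1_norm2 (q t)) t).
  { intros t Ht. repeat split.
    - apply (ex_derive_continuous (fun t => xx (q t))).
      eexists. apply xx_derive, Hq, Ht.
    - apply (ex_derive_continuous (fun t => zz (q t))).
      eexists. apply zz_derive, Hq, Ht.
    - unfold w1_norm2. pose proof (C1_continuous _ _ _ _ Ht Co1).
      pose proof (C1_continuous _ _ _ _ Ht Co2).
      simpl. continuity_of_polynomial. }
  destruct (Req_dec l 0) as [Hl|Hl].
  - exists (fun t => sqrt (xx (q t))). intros t Ht.
    destruct (Hc t Ht) as [H1 _].
    assert (Hp : 0 <= xx (q t)) by (rewrite xx_re_im; nra).
    split; [|split].
    + apply (continuous_comp (fun t => xx (q t)) sqrt); [exact H1|].
      apply continuous_sqrt.
    + apply pow2_sqrt, Hp.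
    + rewrite (w1_norm2_sqrt a b m l) by auto.
      pose proof (radical_square a b m l (q t) h hm (Hx t Ht) (HJ t Ht)) as E.
      rewrite Hl in E |- *.
      assert (m * (xx (q t) + zz (q t)) + w1_norm2 (q t) = 0); [|lra].
      apply Rsqr_0_uniq. unfold Rsqr. lra.
  - exists (fun t => (m * (xx (q t) + zz (q t)) + w1_norm2 (q t)) * / l).
    intros t Ht. destruct (Hc t Ht) as (H1&H2&H3).
    split; [|split].
    + continuity_of_polynomial.
    + rewrite Rpow_mult_distr, (radical_square a b m l) by auto. field. exact Hl.
    + rewrite (w1_norm2_sqrt a b m l) by auto. field. exact Hl.
Qed.

Context (sg : R -> R) (Hsg : radical_along a b m l lo hi q sg).

Lemma radical_along_neq0 t : in_interval lo hi t -> sg t <> 0.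
Proof.
  intros Ht E. apply (Hx t Ht). destruct (Hsg t Ht) as [_ [E1 _]].
  rewrite <- E1, E. ring.
Qed.

Lemma radical_derive t : in_interval lo hi t ->
  is_derive sg t (xx_dot (q t) / (2 * sg t)).
Proof.
  intros Ht. apply is_derive_square_root with (n := fun t => xx (q t)).
  - apply Hsg, Ht.
  - generalize (in_interval_locally lo hi t Ht). apply filter_imp.
    intros s Hs. apply Hsg, Hs.
  - apply xx_derive, Hq, Ht.
  - apply radical_along_neq0, Ht.
Qed.

Lemma separated_derive rho t : in_interval lo hi t ->
  is_derive (fun t => (xx (q t) + zz (q t) + rho) / (2 * sg t)) t
   (((a ^ 2 - b ^ 2 + rho) * c3 (al (q t)) * im_x2w1 (q t)
     + (rho - (a ^ 2 - b ^ 2)) * c3 (be (q t)) * re_x2w1 (q t))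
    / (2 * (xx (q t) * sg t))).
Proof.
  intros Ht.
  pose proof (radical_along_neq0 t Ht) as h4. pose proof (Hx t Ht) as h5.
  eapply is_derive_eq.
  - exact (is_derive_half_quotient _ _ _ rho t _ _ _ (xx_derive q t (Hq t Ht))
             (zz_derive q t (Hq t Ht)) (radical_derive t Ht) h4).
  - cbv beta.
    transitivity ((2 * xx (q t) * (xx_dot (q t) + zz_dot (q t))
      - (xx (q t) + zz (q t) + rho) * xx_dot (q t)) / (4 * xx (q t) * sg t)).
    + rewrite <- (proj1 (proj2 (Hsg t Ht))). field. exact h4.
    + rewrite (separated_dot_numerator a b) by apply (HJ t Ht).
      field. split; assumption.
Qed.

Lemma s1_derive t : in_interval lo hi t ->
  is_derive (fun t => s1 a b (q t) (sg t)) t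
    ((a ^ 2 - b ^ 2) * c3 (al (q t)) * im_x2w1 (q t) * / (xx (q t) * sg t)).
Proof.
  intros Ht. unfold s1. rewrite rc_pow2 by exact h.
  eapply is_derive_eq; [apply separated_derive, Ht|].
  pose proof (radical_along_neq0 t Ht). pose proof (Hx t Ht).
  field. split; assumption.
Qed.

Lemma s2_derive t : in_interval lo hi t ->
  is_derive (fun t => s2 a b (q t) (sg t)) t
    (- (a ^ 2 - b ^ 2) * c3 (be (q t)) * re_x2w1 (q t) * / (xx (q t) * sg t)).
Proof.
  intros Ht. unfold s2. rewrite rc_pow2 by exact h.
  eapply is_derive_eq; [apply (separated_derive (- (a ^ 2 - b ^ 2))), Ht|].
  pose proof (radical_along_neq0 t Ht). pose proof (Hx t Ht).
  field. split; assumption.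
Qed.

Lemma separated_derivatives_C1 :
  C1_on lo hi (fun t =>
    (a ^ 2 - b ^ 2) * c3 (al (q t)) * im_x2w1 (q t) * / (xx (q t) * sg t)) /\
  C1_on lo hi (fun t =>
    - (a ^ 2 - b ^ 2) * c3 (be (q t)) * re_x2w1 (q t) * / (xx (q t) * sg t)).
Proof.
  destruct (components_C1 lo hi q Hq) as ((Co1&Co2)&(Ca1&Ca2&Ca3)&(Cb1&Cb2&Cb3)).
  assert (Cr : C1_on lo hi (fun t => re_x1 (q t))) by (unfold re_x1; C1_tac).
  assert (Ci : C1_on lo hi (fun t => im_x1 (q t))) by (unfold im_x1; C1_tac).
  assert (Cd : C1_on lo hi (fun t => xx_dot (q t))).
  { unfold xx_dot, im_x2w1, re_x2w1. C1_tac. }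
  assert (Cx : C1_on lo hi (fun t => xx (q t))).
  { exists (fun t => xx_dot (q t)).
    intros t Ht. split; [apply xx_derive, Hq, Ht|].
    apply (C1_continuous lo hi); [exact Ht|exact Cd]. }
  assert (Cs : C1_on lo hi sg).
  { exists (fun t => xx_dot (q t) / (2 * sg t)).
    intros t Ht. split; [apply radical_derive, Ht|].
    apply (continuous_mult (fun t => xx_dot (q t)) (fun t => / (2 * sg t))).
    - apply (C1_continuous lo hi); [exact Ht|exact Cd].
    - apply (continuous_comp (fun t => 2 * sg t) Rinv).
      + apply (continuous_scal_r 2 sg). apply Hsg, Ht.
      + apply continuous_Rinv. pose proof (radical_along_neq0 t Ht). lra. }
  unfold im_x2w1, re_x2w1.
  split; C1_tac; intros t Ht;
    apply Rmult_integral_contrapositive_currified; auto using radical_along_neq0.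
Qed.

Lemma reduction_separated :
  separated_system a b m l lo hi
    (fun t => s1 a b (q t) (sg t)) (fun t => s2 a b (q t) (sg t)).
Proof.
  destruct separated_derivatives_C1 as [[f1 H1] [f2 H2]]. split.
  - eexists. exists f1. intros t Ht.
    split; [apply s1_derive, Ht|]. split; [apply H1, Ht|]. split; [apply H1, Ht|].
    destruct (Hsg t Ht) as (_&h5&h6).
    rewrite (s1_gap a b m l), (Phi_s1 a b m l) by auto.
    pose proof (radical_along_neq0 t Ht) as h4. rewrite <- h5. field. exact h4.
  - eexists. exists f2. intros t Ht.
    split; [apply s2_derive, Ht|]. split; [apply H2, Ht|]. split; [apply H2, Ht|].
    destruct (Hsg t Ht) as (_&h5&h6).
    rewrite (s2_gap a b m l), (Phi_s2 a b m l) by auto.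
    pose proof (radical_along_neq0 t Ht) as h4. rewrite <- h5. field. exact h4.
Qed.
End Reduction.

(** * Jacobi elliptic functions *)

(** [dn] is the delta amplitude.  Only the interval (- pi/2, pi/2) is required of the
    range of the amplitude, because for [k = 1] the range is exactly this interval. *)
Definition amplitude_with (k : R) (am dn : R -> R) : Prop :=
  is_amplitude k am /\
  (forall u, is_derive am u (dn u)) /\
  (forall u, 0 < dn u) /\ (forall u, dn u ^ 2 = 1 - k ^ 2 * sin (am u) ^ 2) /\
  (forall th, - (PI / 2) < th < PI / 2 -> exists u, am u = th).

Section ModulusBelowOne.
Context (k : R) (hk : 0 <= k < 1).
Notation f := (fun th => / sqrt (1 - k ^ 2 * sin th ^ 2)).

Lemma modulus_radicand th : 0 < 1 - k ^ 2 * sin th ^ 2 <= 1.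
Proof.
  pose proof (sin2_cos2 th) as h. rewrite !Rsqr_pow2 in h.
  pose proof (pow2_ge_0 (sin th)). pose proof (pow2_ge_0 (cos th)).
  assert (0 <= k ^ 2 < 1) by nra. nra.
Qed.

Lemma integrand_continuous th : continuous f th.
Proof.
  apply (ex_derive_continuous f). pose proof (modulus_radicand th).
  auto_derive. repeat split; [simpl in *; lra|]. apply Rgt_not_eq, sqrt_lt_R0. simpl in *; lra.
Qed.

Lemma integrand_ge1 th : 1 <= f th.
Proof.
  pose proof (modulus_radicand th) as [H1 H2]. pose proof (sqrt_lt_R0 _ H1).
  assert (H3 := sqrt_le_1 (1 - k ^ 2 * sin th ^ 2) 1 ltac:(lra) ltac:(lra) H2).
  rewrite sqrt_1 in H3.
  rewrite <- Rinv_1 at 1. apply Rinv_le_contravar; assumption.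
Qed.

Definition incomplete_elliptic (th : R) : R := RInt f 0 th.

Lemma incomplete_elliptic_correct th : is_RInt f 0 th (incomplete_elliptic th).
Proof.
  apply (RInt_correct f 0 th), (ex_RInt_continuous f 0 th). intros z _.
  apply integrand_continuous.
Qed.

Lemma incomplete_elliptic_derive th : is_derive incomplete_elliptic th (f th).
Proof.
  apply (is_derive_RInt f incomplete_elliptic 0 th).
  - apply filter_forall. intros x. apply incomplete_elliptic_correct.
  - apply integrand_continuous.
Qed.

Lemma incomplete_elliptic_increment x y : exists c, Rmin x y <= c <= Rmax x y /\
   incomplete_elliptic y - incomplete_elliptic x = f c * (y - x).
Proof.
  destruct (MVT_gen incomplete_elliptic x y f) as [c Hc].
  - intros z _. apply incomplete_elliptic_derive.
  - intros z _. apply continuity_pt_filterlim.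
    apply (ex_derive_continuous incomplete_elliptic). eexists.
    apply incomplete_elliptic_derive.
  - exists c. exact Hc.
Qed.

(** The integrand is at least 1, so the elliptic integral of the first kind expands
    distances: it is injective, onto, and its inverse is 1-Lipschitz. *)
Lemma incomplete_elliptic_expands x y :
  Rabs (y - x) <= Rabs (incomplete_elliptic y - incomplete_elliptic x).
Proof.
  destruct (incomplete_elliptic_increment x y) as [c [_ E]]. rewrite E, Rabs_mult.
  pose proof (integrand_ge1 c). rewrite (Rabs_pos_eq (f c)) by lra.
  pose proof (Rabs_pos (y - x)). nra.
Qed.

Lemma incomplete_elliptic_onto u : exists th, incomplete_elliptic th = u.
Proof.
  assert (F0 : incomplete_elliptic 0 = 0) by apply (RInt_point 0 f).
  assert (Hc : forall x y, x <= y -> y - x <= incomplete_elliptic y - incomplete_elliptic x).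
  { intros x y Hxy. destruct (incomplete_elliptic_increment x y) as [c [_ E]]. rewrite E.
    pose proof (integrand_ge1 c). nra. }
  pose proof (Rabs_pos u). pose proof (Rle_abs u). pose proof (Rle_abs (- u)).
  rewrite Rabs_Ropp in *.
  destruct (IVT_gen incomplete_elliptic (- Rabs u) (Rabs u) u) as [x [_ Hx]].
  - intros z. apply continuity_pt_filterlim.
    apply (ex_derive_continuous incomplete_elliptic). eexists.
    apply incomplete_elliptic_derive.
  - pose proof (Hc (- Rabs u) 0). pose proof (Hc 0 (Rabs u)).
    rewrite Rmin_left, Rmax_right by lra. lra.
  - exists x. exact Hx.
Qed.

Lemma amplitude_exists_lt1 : exists am dn, amplitude_with k am dn.
Proof.
  set (am := fun u =>
    proj1_sig (constructive_indefinite_description _ (incomplete_elliptic_onto u))).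
  assert (Ham : forall u, incomplete_elliptic (am u) = u).
  { intros u. unfold am. destruct constructive_indefinite_description as [th Hth]. exact Hth. }
  clearbody am.
  assert (Hinj : forall th, am (incomplete_elliptic th) = th).
  { intros th. pose proof (incomplete_elliptic_expands th (am (incomplete_elliptic th))) as E.
    rewrite Ham, Rminus_diag, Rabs_R0 in E.
    pose proof (Rabs_pos (am (incomplete_elliptic th) - th)).
    apply Rminus_diag_uniq.
    destruct (Req_dec (am (incomplete_elliptic th) - th) 0) as [Z|Z]; [exact Z|].
    pose proof (Rabs_pos_lt _ Z). lra. }
  exists am, (fun u => sqrt (1 - k ^ 2 * sin (am u) ^ 2)).
  split; [|split; [|split; [|split]]].
  - intros u. rewrite <- (Ham u) at 2. apply incomplete_elliptic_correct.
  - intros u.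
    (* By the mean value theorem the difference quotient of the inverse is [/ f] at an
       intermediate point, which tends to [am u]. *)
    assert (Hg : continuous (fun th => sqrt (1 - k ^ 2 * sin th ^ 2)) (am u)).
    { apply (ex_derive_continuous (fun th => sqrt (1 - k ^ 2 * sin th ^ 2))).
      pose proof (modulus_radicand (am u)). auto_derive. simpl in *; lra. }
    apply is_derive_Reals. intros eps Heps.
    destruct (proj1 (filterlim_locally _ _) Hg (mkposreal eps Heps)) as [d Hd].
    exists d. intros x Hx0 Hx.
    destruct (incomplete_elliptic_increment (am u) (am (u + x))) as [c [Hc E]].
    rewrite !Ham in E. replace (u + x - u) with x in E by ring.
    pose proof (modulus_radicand c) as [P1 _]. pose proof (sqrt_lt_R0 _ P1).
    replace ((am (u + x) - am u) / x) with (sqrt (1 - k ^ 2 * sin c ^ 2)).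
    + apply Hd. apply Rle_lt_trans with (2 := Hx).
      pose proof (incomplete_elliptic_expands (am u) (am (u + x))) as Ex.
      rewrite !Ham in Ex. replace (u + x - u) with x in Ex by ring.
      apply Rle_trans with (2 := Ex).
      change (Rabs (c - am u) <= Rabs (am (u + x) - am u)).
      revert Hc. unfold Rmin, Rmax, Rabs. destruct Rle_dec; repeat destruct Rcase_abs; lra.
    + rewrite E at 2. field. split; [lra|]. intros Z. apply Hx0. rewrite E, Z. ring.
  - intros u. apply sqrt_lt_R0, modulus_radicand.
  - intros u. apply pow2_sqrt. left. apply modulus_radicand.
  - intros th _. exists (incomplete_elliptic th). apply Hinj.
Qed.
End ModulusBelowOne.

(** For [k = 1] the amplitude is the Gudermannian function [atan (sinh u)]. *)
Lemma amplitude_exists_1 : exists am dn, amplitude_with 1 am dn.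
Proof.
  exists (fun u => atan (sinh u)), (fun u => cos (atan (sinh u))).
  assert (Hcos : forall u, 0 < cos (atan u)).
  { intros u. destruct (atan_bound u). apply cos_gt_0; lra. }
  assert (Hder : forall u, is_derive (fun u => atan (sinh u)) u (cos (atan (sinh u)))).
  { intros u.
    assert (Hsh : is_derive sinh u (cosh u)) by (apply is_derive_Reals, derivable_pt_lim_sinh).
    eapply is_derive_eq.
    - apply (is_derive_comp atan sinh u _ _ (is_derive_atan _) Hsh).
    - unfold scal; simpl; unfold mult; simpl. rewrite cos_atan.
      assert (E : 1 + Rsqr (sinh u) = Rsqr (cosh u)).
      { unfold sinh, cosh, Rsqr. pose proof (exp_plus u (-u)) as E.
        rewrite Rplus_opp_r, exp_0 in E. nra. }
      assert (0 < cosh u) by (unfold cosh; pose proof (exp_pos u);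
        pose proof (exp_pos (-u)); lra).
      replace (1 + sinh u * (sinh u * 1)) with (1 + Rsqr (sinh u)) by (unfold Rsqr; ring).
      rewrite E, sqrt_Rsqr by lra. unfold Rsqr. field. lra. }
  assert (Hsq : forall u, 1 - 1 ^ 2 * sin (atan u) ^ 2 = cos (atan u) ^ 2).
  { intros u. pose proof (sin2_cos2 (atan u)) as h. rewrite !Rsqr_pow2 in h. lra. }
  split; [|split; [|split; [|split]]].
  - intros u.
    (* The substitution [th = atan (sinh u)] turns the integrand into 1. *)
    set (f := fun th => / sqrt (1 - 1 ^ 2 * sin th ^ 2)).
    assert (Hf : forall z, - (PI / 2) < z < PI / 2 -> continuous f z).
    { intros z Hz. apply (ex_derive_continuous f). unfold f.
      assert (Hz1 : 0 < 1 - 1 ^ 2 * sin z ^ 2).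
      { rewrite <- (atan_tan z) by lra. rewrite Hsq. apply pow_lt, Hcos. }
      auto_derive. split; [simpl in *; lra|split; [apply Rgt_not_eq, sqrt_lt_R0;
        simpl in *; lra|trivial]]. }
    assert (E0 : atan (sinh 0) = 0) by (rewrite sinh_0, atan_0; reflexivity).
    assert (Hcont : forall v, continuous (fun u => cos (atan (sinh u))) v).
    { intros v. apply (continuous_comp (fun u => atan (sinh u)) cos).
      - apply (ex_derive_continuous (fun u => atan (sinh u))). eexists. apply Hder.
      - apply continuous_cos. }
    assert (Hint : ex_RInt f 0 (atan (sinh u))).
    { apply (ex_RInt_continuous f). intros z Hz. apply Hf.
      destruct (atan_bound (sinh u)). revert Hz. unfold Rmin, Rmax. destruct Rle_dec; lra. }
    pose proof (is_RInt_comp f (fun u => atan (sinh u))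
                  (fun u => cos (atan (sinh u))) 0 u) as Hc.
    cbv beta in Hc. rewrite E0 in Hc.
    assert (Hc1 : is_RInt (fun y => scal (cos (atan (sinh y))) (f (atan (sinh y)))) 0 u
                    (RInt f 0 (atan (sinh u)))).
    { apply Hc.
      - intros x _. apply Hf. destruct (atan_bound (sinh x)). lra.
      - intros x _. split; [apply Hder|apply Hcont]. }
    assert (Hc2 : is_RInt (fun y => scal (cos (atan (sinh y))) (f (atan (sinh y)))) 0 u u).
    { apply (is_RInt_ext (fun _ => 1)).
      - intros x _. unfold f. rewrite Hsq, sqrt_pow2 by (left; apply Hcos).
        unfold scal; simpl; unfold mult; simpl. field. apply Rgt_not_eq, Hcos.
      - pose proof (is_RInt_const 0 u 1) as Hk.
        replace u with (scal (u - 0) 1) at 2 by (unfold scal; simpl; unfold mult; simpl;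
          ring). exact Hk. }
    pose proof (RInt_correct f _ _ Hint) as R1.
    rewrite <- (is_RInt_unique _ _ _ _ Hc1), (is_RInt_unique _ _ _ _ Hc2) in R1. exact R1.
  - exact Hder.
  - intros u. apply Hcos.
  - intros u. rewrite Hsq. reflexivity.
  - intros th Hth. exists (arcsinh (tan th)). rewrite sinh_arcsinh. apply atan_tan. lra.
Qed.

Lemma amplitude_exists k : 0 <= k <= 1 -> exists am dn, amplitude_with k am dn.
Proof.
  intros hk. destruct (Req_dec k 1) as [->|Hk].
  - exact amplitude_exists_1.
  - apply amplitude_exists_lt1. lra.
Qed.

Section JacobiFunctions.
Context (k : R) (am dn : R -> R) (Ha : amplitude_with k am dn).

Lemma sn_derive u : is_derive (sn am) u (cn am u * dn u).
Proof.
  destruct Ha as (_&H1&_). eapply is_derive_eq.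
  - apply (is_derive_comp sin am u _ _ (is_derive_sin _) (H1 u)).
  - unfold scal; simpl; unfold mult; simpl. unfold cn. ring.
Qed.

Lemma cn_derive u : is_derive (cn am) u (- sn am u * dn u).
Proof.
  destruct Ha as (_&H1&_). eapply is_derive_eq.
  - apply (is_derive_comp cos am u _ _ (is_derive_cos _) (H1 u)).
  - unfold scal; simpl; unfold mult; simpl. unfold sn. ring.
Qed.

Lemma dn_square u : dn u ^ 2 = 1 - k ^ 2 * sn am u ^ 2.
Proof. apply Ha. Qed.

Lemma cn_square u : cn am u ^ 2 = 1 - sn am u ^ 2.
Proof. unfold cn, sn. pose proof (sin2_cos2 (am u)) as h. rewrite !Rsqr_pow2 in h. lra. Qed.

Lemma dn_derive u : is_derive dn u (- k ^ 2 * sn am u * cn am u).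
Proof.
  pose proof (proj1 (proj2 (proj2 Ha))) as Hp.
  apply (is_derive_ext (fun u => sqrt (1 - k ^ 2 * sn am u ^ 2))).
  { intros v. rewrite <- dn_square. apply sqrt_pow2. left. apply Hp. }
  pose proof (sn_derive u) as Hs. pose proof (Hp u) as Hpu.
  assert (E : sqrt (1 - k ^ 2 * sn am u ^ 2) = dn u) by (rewrite <- dn_square;
    apply sqrt_pow2; lra).
  assert (Hd : is_derive (fun u => 1 - k ^ 2 * sn am u ^ 2) u
                 (- (k ^ 2 * (2 * (sn am u * (cn am u * dn u)))))).
  { eapply is_derive_eq.
    - apply (is_derive_minus (fun _ => 1) (fun u => k ^ 2 * sn am u ^ 2));
        [exact (is_derive_const 1 u)|].
      apply (is_derive_scal (fun u => sn am u ^ 2)). apply (is_derive_pow (sn am) 2). exact Hs.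
    - unfold minus, plus, opp, zero; simpl. ring. }
  eapply is_derive_eq.
  - apply (is_derive_comp sqrt (fun u => 1 - k ^ 2 * sn am u ^ 2) u
             (/ (2 * sqrt (1 - k ^ 2 * sn am u ^ 2)))); [|exact Hd].
    apply is_derive_Reals, derivable_pt_lim_sqrt. rewrite <- dn_square. apply pow_lt, Hpu.
  - rewrite E. unfold scal; simpl; unfold mult; simpl. field. lra.
Qed.

(** [sn'^2 = sn_quartic sn] and [sn'' = dsn_quartic sn / 2]. *)
Definition sn_quartic (y : R) : R := (1 - y ^ 2) * (1 - k ^ 2 * y ^ 2).
Definition dsn_quartic (y : R) : R :=
  - 2 * y * (1 - k ^ 2 * y ^ 2) - 2 * k ^ 2 * y * (1 - y ^ 2).

Lemma sn_quartic_derive y : is_derive sn_quartic y (dsn_quartic y).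
Proof. unfold sn_quartic, dsn_quartic. auto_derive; [trivial|ring]. Qed.

Lemma sn_first_order u : (cn am u * dn u) ^ 2 = sn_quartic (sn am u).
Proof. rewrite Rpow_mult_distr, cn_square, dn_square. reflexivity. Qed.

Lemma sn_second_order u : is_derive (fun u => cn am u * dn u) u (dsn_quartic (sn am u) / 2).
Proof.
  eapply is_derive_eq.
  - apply (is_derive_mult (cn am) dn u _ _ (cn_derive u) (dn_derive u)).
    intros; apply Rmult_comm.
  - unfold plus, mult; simpl.
    transitivity (- sn am u * dn u ^ 2 - k ^ 2 * sn am u * cn am u ^ 2); [ring|].
    rewrite dn_square, cn_square. unfold dsn_quartic. field.
Qed.

(** [cn = 0] forces [sn^2 = 1], and [1 - k^2 = dn^2] is positive there. *)
Lemma sn_turning u : cn am u * dn u = 0 -> dsn_quartic (sn am u) <> 0.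
Proof.
  intros E. pose proof (proj1 (proj2 (proj2 Ha)) u) as Hp.
  assert (Z : cn am u = 0) by (apply Rmult_integral in E; destruct E; [assumption|lra]).
  pose proof (cn_square u) as C2. pose proof (dn_square u) as D2.
  pose proof (pow_lt _ 2 Hp) as D3.
  rewrite Z in C2. assert (S2 : sn am u ^ 2 = 1) by lra.
  unfold dsn_quartic. rewrite S2.
  assert (sn am u <> 0) by (intros Y; rewrite Y in S2; lra).
  rewrite S2 in D2. rewrite Rminus_diag, Rmult_0_r, Rminus_0_r.
  apply Rmult_integral_contrapositive_currified; [lra|]. lra.
Qed.

Lemma sn_onto y : -1 < y < 1 -> exists u, sn am u = y.
Proof.
  intros Hy. destruct (proj2 (proj2 (proj2 (proj2 Ha))) (asin y)) as [u Hu].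
  { apply asin_bound_lt. exact Hy. }
  exists u. unfold sn. rewrite Hu. apply sin_asin. lra.
Qed.
End JacobiFunctions.

(** For [k = 1] the function [cn] is the hyperbolic secant, a solution of
    [y'^2 = y^2 (1 - y^2)] asymptotic to the double root 0. *)
Section HyperbolicSecant.
Context (am dn : R -> R) (Ha : amplitude_with 1 am dn).
Definition cn1_quartic (y : R) : R := y ^ 2 * (1 - y ^ 2).
Definition dcn1_quartic (y : R) : R := 2 * y - 4 * y ^ 3.

Lemma cn1_quartic_derive y : is_derive cn1_quartic y (dcn1_quartic y).
Proof. unfold cn1_quartic, dcn1_quartic. auto_derive; [trivial|ring]. Qed.

Lemma dn1_square u : dn u ^ 2 = cn am u ^ 2.
Proof. rewrite (dn_square 1 am dn Ha), cn_square. ring. Qed.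

Lemma cn1_first_order u : (- sn am u * dn u) ^ 2 = cn1_quartic (cn am u).
Proof.
  rewrite Rpow_mult_distr, dn1_square. unfold cn1_quartic. rewrite cn_square. ring.
Qed.

Lemma cn1_second_order u :
  is_derive (fun u => - sn am u * dn u) u (dcn1_quartic (cn am u) / 2).
Proof.
  assert (Hv : forall v, - (sn am v * dn v) = - sn am v * dn v) by (intros; ring).
  apply (is_derive_ext _ _ u _ Hv).
  eapply is_derive_eq.
  - apply (is_derive_opp (fun u => sn am u * dn u)).
    apply (is_derive_mult (sn am) dn u _ _
      (sn_derive 1 am dn Ha u) (dn_derive 1 am dn Ha u)).
    intros; apply Rmult_comm.
  - unfold opp, plus, mult; simpl.
    transitivity (- cn am u * dn u ^ 2 + sn am u ^ 2 * cn am u); [ring|].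
    pose proof (cn_square am u) as E. replace (sn am u ^ 2) with (1 - cn am u ^ 2) by lra.
    rewrite dn1_square. unfold dcn1_quartic. field.
Qed.

Lemma cn1_turning u : - sn am u * dn u = 0 -> dcn1_quartic (cn am u) <> 0.
Proof.
  intros E. pose proof (proj1 (proj2 (proj2 Ha)) u) as Hp.
  assert (Z : sn am u = 0) by (apply Rmult_integral in E; destruct E; lra).
  pose proof (cn_square am u) as C2. rewrite Z in C2.
  unfold dcn1_quartic. intros E2.
  assert (E3 : cn am u * (2 - 4 * cn am u ^ 2) = 0) by (rewrite <- E2; ring).
  rewrite C2 in E3. assert (cn am u = 0) by lra. rewrite H in C2. lra.
Qed.

Lemma cn1_onto y : 0 < y < 1 -> exists u, cn am u = y.
Proof.
  intros Hy. destruct (proj2 (proj2 (proj2 (proj2 Ha))) (acos y)) as [u Hu].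
  { pose proof (acos_bound_lt y ltac:(lra)) as [A1 A2]. split; [pose proof PI_RGT_0; lra|].
    destruct (Rlt_dec (acos y) (PI / 2)) as [L|L]; [exact L|].
    pose proof (cos_le_0 (acos y) ltac:(lra) ltac:(lra)) as L2.
    rewrite cos_acos in L2 by lra. lra. }
  exists u. unfold cn. rewrite Hu. apply cos_acos. lra.
Qed.
End HyperbolicSecant.

(** * Fractional linear images of Jacobi functions *)

Definition quartic (k p q r t s : R) : R := k * (s - p) * (s - q) * (s - r) * (s - t).
Definition dquartic (k p q r t s : R) : R :=
  k * ((s - q) * (s - r) * (s - t) + (s - p) * (s - r) * (s - t) +
       (s - p) * (s - q) * (s - t) + (s - p) * (s - q) * (s - r)).

Lemma quartic_derive k p q r t s : is_derive (quartic k p q r t) s (dquartic k p q r t s).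
Proof. unfold quartic, dquartic. auto_derive; [trivial|ring]. Qed.

Lemma dquartic_continuous k p q r t s : continuous (dquartic k p q r t) s.
Proof.
  apply (ex_derive_continuous (dquartic k p q r t)). unfold dquartic.
  auto_derive; trivial.
Qed.

Lemma dquartic_lipschitz k p q r t (x y : R -> R) (t0 : R) :
  continuous x t0 -> continuous y t0 ->
  exists c, 0 <= c /\
  locally t0 (fun u =>
    Rabs (dquartic k p q r t (x u) / 2 - dquartic k p q r t (y u) / 2)
    <= c * Rabs (x u - y u)).
Proof.
  intros Hx Hy.
  set (e1 := p + q + r + t). set (e2 := p*q+p*r+p*t+q*r+q*t+r*t).
  set (Q := fun u =>
    k * (2 * (x u * x u + x u * y u + y u * y u) - 3 / 2 * e1 * (x u + y u) + e2)).
  assert (HQ : continuous Q t0).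
  { unfold Q. continuity_of_polynomial. }
  exists (Rabs (Q t0) + 1). split; [pose proof (Rabs_pos (Q t0)); lra|].
  assert (HQ1 : locally t0 (fun u => Rabs (Q u) < Rabs (Q t0) + 1)).
  { assert (HQa : continuous (fun u => Rabs (Q u)) t0)
      by (apply (continuous_comp Q Rabs); [exact HQ|apply continuous_Rabs]).
    apply (HQa (fun z => z < Rabs (Q t0) + 1)). apply (open_lt (Rabs (Q t0) + 1)). lra. }
  revert HQ1. apply filter_imp. intros u Hu.
  replace (dquartic k p q r t (x u) / 2 - dquartic k p q r t (y u) / 2)
    with (Q u * (x u - y u))
    by (unfold Q, e1, e2, dquartic; field).
  rewrite Rabs_mult. apply Rmult_le_compat_r; [apply Rabs_pos|lra].
Qed.

Section FirstToSecondOrder.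
Context (k p q r t : R) (s ds dds : R -> R).
Notation P := (quartic k p q r t).
Notation dP := (dquartic k p q r t).
Definition solves (u : R) : Prop :=
   is_derive s u (ds u) /\ is_derive ds u (dds u) /\ continuous dds u /\ ds u ^ 2 = P (s u).

(** Differentiate [s'^2 = P s] and divide by [2 s']. *)
Lemma second_order_where_moving u : locally u solves -> ds u <> 0 -> dds u = dP (s u) / 2.
Proof.
  intros Hs H0. destruct (locally_singleton _ _ Hs) as (h1&h2&_).
  assert (E : is_derive (fun u => ds u ^ 2) u (2 * ds u * dds u)).
  { eapply is_derive_eq; [apply (is_derive_pow _ 2), h2|]. simpl. ring. }
  assert (E2 : is_derive (fun u => ds u ^ 2) u (ds u * dP (s u))).
  { apply (is_derive_ext_loc (fun u => P (s u))).
    - revert Hs. apply filter_imp. intros v (_&_&_&Hv). symmetry; exact Hv.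
    - exact (is_derive_comp P s u _ _ (quartic_derive _ _ _ _ _ _) h1). }
  pose proof (is_derive_unique _ _ _ E) as U1. rewrite (is_derive_unique _ _ _ E2) in U1.
  apply (Rmult_eq_reg_l (2 * ds u)); [lra|lra].
Qed.

(** If [s' u = 0], then [s'' u <> 0] makes [u] an isolated zero of [s']. *)
Lemma second_order_nearby u :
  locally u solves -> dds u = dP (s u) / 2 -> ds u <> 0 \/ dds u <> 0 ->
  locally u (fun v => dds v = dP (s v) / 2).
Proof.
  intros Hs H0 Hm.
  assert (Hp : locally u (fun v => v <> u -> ds v <> 0)).
  { destruct (locally_singleton _ _ Hs) as (h1&h2&_).
    destruct (Req_dec (ds u) 0) as [E|E].
    - destruct Hm as [Hm|Hm]; [contradiction|]. exact (derive_nonzero_punctured _ _ _ h2 E Hm).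
    - assert (C1 : continuous ds u) by (apply (ex_derive_continuous ds); eexists; exact h2).
      generalize (continuous_nonzero _ _ C1 E). apply filter_imp. auto. }
  generalize (filter_and _ _ (locally_locally _ _ Hs) Hp). apply filter_imp.
  intros v [Hv1 Hv2]. destruct (Req_dec v u) as [->|Hne]; [exact H0|].
  apply second_order_where_moving; auto.
Qed.
End FirstToSecondOrder.

(** The hypothesis [Hid] says that the Moebius map [y |-> (A0 + A1 y) / (B0 + B1 y)]
    carries the form [dy^2 / (nu^2 Q y)] to [ds^2 / P s]; it is written without
    denominators because the image of [e] may pass through infinity. *)
Section Mobius.
Context (k p q r t : R).
Notation P := (quartic k p q r t).
Notation dP := (dquartic k p q r t).
Context (e de Q dQ : R -> R) (A0 A1 B0 B1 nu : R).
Context (He : forall u, is_derive e u (de u)) (Hde : forall u, is_derive de u (dQ (e u) / 2))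
  (Heq : forall u, de u ^ 2 = Q (e u)) (Hturn : forall u, de u = 0 -> dQ (e u) <> 0)
  (HQ : forall y, is_derive Q y (dQ y)).
Notation delta := (A1 * B0 - A0 * B1).
Context (Hdelta : delta <> 0).
Context (Hid : forall y,
  k * ((A0 + A1 * y) - p * (B0 + B1 * y)) * ((A0 + A1 * y) - q * (B0 + B1 * y))
    * ((A0 + A1 * y) - r * (B0 + B1 * y)) * ((A0 + A1 * y) - t * (B0 + B1 * y))
  = delta ^ 2 * nu ^ 2 * Q y).

Lemma mobius_first_order y : B0 + B1 * y <> 0 ->
  P ((A0 + A1 * y) / (B0 + B1 * y)) = delta ^ 2 * nu ^ 2 * Q y / (B0 + B1 * y) ^ 4.
Proof.
  intros HB. rewrite <- Hid. unfold quartic. field. exact HB.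
Qed.

(** Differentiate [Hid] in [y]; for the numerator [A] and the denominator [B] of the
    Moebius map, [A1 B - B1 A] is the constant [delta]. *)
Lemma mobius_second_order y : B0 + B1 * y <> 0 ->
  delta * (nu ^ 2 * (dQ y / 2) * (B0 + B1 * y) - 2 * B1 * nu ^ 2 * Q y)
    / (B0 + B1 * y) ^ 3
  = dP ((A0 + A1 * y) / (B0 + B1 * y)) / 2.
Proof.
  intros HB.
  assert (E : is_derive (fun y => delta ^ 2 * nu ^ 2 * Q y) y (delta ^ 2 * nu ^ 2 * dQ y)).
  { apply (is_derive_scal Q y (delta ^ 2 * nu ^ 2)). apply HQ. }
  apply (is_derive_ext _ _ y _ (fun y => eq_sym (Hid y))) in E.
  assert (E' : forall n0 n1 n2 n3 m0 m1 m2 m3,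
    is_derive (fun y =>
      k * (n0 + m0 * y) * (n1 + m1 * y) * (n2 + m2 * y) * (n3 + m3 * y)) y
      (k * (m0 * (n1 + m1 * y) * (n2 + m2 * y) * (n3 + m3 * y)
            + m1 * (n0 + m0 * y) * (n2 + m2 * y) * (n3 + m3 * y)
            + m2 * (n0 + m0 * y) * (n1 + m1 * y) * (n3 + m3 * y)
            + m3 * (n0 + m0 * y) * (n1 + m1 * y) * (n2 + m2 * y)))).
  { intros. auto_derive; [trivial|ring]. }
  specialize (E' (A0 - p * B0) (A0 - q * B0) (A0 - r * B0) (A0 - t * B0)
                 (A1 - p * B1) (A1 - q * B1) (A1 - r * B1) (A1 - t * B1)).
  assert (Ept : forall z,
    k * (A0 - p * B0 + (A1 - p * B1) * z) * (A0 - q * B0 + (A1 - q * B1) * z)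
      * (A0 - r * B0 + (A1 - r * B1) * z) * (A0 - t * B0 + (A1 - t * B1) * z)
    = k * ((A0 + A1 * z) - p * (B0 + B1 * z)) * ((A0 + A1 * z) - q * (B0 + B1 * z))
      * ((A0 + A1 * z) - r * (B0 + B1 * z)) * ((A0 + A1 * z) - t * (B0 + B1 * z)))
    by (intros z; ring).
  apply (is_derive_ext _ _ y _ Ept) in E'.
  pose proof (eq_trans (eq_sym (is_derive_unique _ _ _ E')) (is_derive_unique _ _ _ E)) as U.
  apply (Rmult_eq_reg_l (2 * delta * (B0 + B1 * y) ^ 3)).
  2: nonzero.
  transitivity ((B0 + B1 * y) * (delta ^ 2 * nu ^ 2 * dQ y)
                - 4 * B1 * (delta ^ 2 * nu ^ 2 * Q y)).
  { field. exact HB. }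
  rewrite <- U, <- Hid. unfold dquartic. field. exact HB.
Qed.

Context (lo hi : Rbar) (s ds dds : R -> R) (t1 u0 : R).
Context (Hs : forall u, in_interval lo hi u -> solves k p q r t s ds dds u)
  (Hnu : nu <> 0)
  (H1 : in_interval lo hi t1) (Hm : ds t1 <> 0)
  (Hu0 : s t1 * (B0 + B1 * e u0) = A0 + A1 * e u0).

(** The numerator and the denominator have no common zero, as [delta <> 0]. *)
Lemma mobius_denominator x y : x * (B0 + B1 * y) = A0 + A1 * y -> B0 + B1 * y <> 0.
Proof.
  intros E HB. rewrite HB in E. apply Hdelta.
  destruct (Req_dec B1 0) as [Z|Z].
  - rewrite Z in *. assert (B0 = 0) by lra. subst. ring.
  - assert (y = - B0 / B1) by (apply (Rmult_eq_reg_l B1); [field_simplify; lra|exact Z]).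
    subst y.
    transitivity (- B1 * (A0 + A1 * (- B0 / B1))); [field; exact Z|rewrite <- E; ring].
Qed.

(** The derivatives of [s] and of the candidate have equal squares, and the sign of
    the frequency [w] makes them equal. *)
Lemma mobius_frequency : exists w,
  w ^ 2 = nu ^ 2 /\ w <> 0 /\
  ds t1 = delta * (w * de u0) / (B0 + B1 * e u0) ^ 2.
Proof.
  pose proof (mobius_denominator _ _ Hu0) as HB.
  assert (E : ds t1 ^ 2 = (delta * (nu * de u0) / (B0 + B1 * e u0) ^ 2) ^ 2).
  { destruct (Hs t1 H1) as (_&_&_&E). rewrite E.
    replace (s t1) with ((A0 + A1 * e u0) / (B0 + B1 * e u0)) by (rewrite <- Hu0; field;
      exact HB).
    rewrite mobius_first_order by exact HB. rewrite <- Heq. field. exact HB. }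
  apply pow2_eq_cases in E. destruct E as [E|E].
  - exists nu. auto.
  - assert (w2 : (- nu) ^ 2 = nu ^ 2) by ring. assert (w0 : - nu <> 0) by lra.
    exists (Ropp nu). split; [exact w2|split; [exact w0|]]. rewrite E. field. exact HB.
Qed.

(** With [W = s B - A], where [A / B] is the candidate, the set of times where
    [W = W' = 0] and [s'' = P'(s) / 2] is open and closed in the interval.  On it
    [B] does not vanish, so [s] never meets a pole of the candidate.  The second
    order equation belongs to the condition because [s] is only known to satisfy it
    where it moves. *)
Lemma mobius_solution : exists w t0, forall u, in_interval lo hi u ->
  B0 + B1 * e (w * (u - t0)) <> 0 /\
  s u = (A0 + A1 * e (w * (u - t0))) / (B0 + B1 * e (w * (u - t0))).
Proof.
  destruct mobius_frequency as (w&Hw2&Hw&Hs1).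
  exists w, (t1 - u0 / w).
  set (y := fun u => e (w * (u - (t1 - u0 / w)))).
  set (dy := fun u => w * de (w * (u - (t1 - u0 / w)))).
  assert (Hy : forall u, is_derive y u (dy u)).
  { intros u. unfold y, dy. eapply is_derive_eq.
    - apply (is_derive_comp e (fun u => w * (u - (t1 - u0 / w)))); [apply He|].
      auto_derive; [trivial|reflexivity].
    - unfold scal; simpl; unfold mult; simpl; ring. }
  assert (Hdy : forall u, is_derive dy u (nu ^ 2 * (dQ (y u) / 2))).
  { intros u. unfold dy, y. eapply is_derive_eq.
    - apply (is_derive_scal (fun u => de (w * (u - (t1 - u0 / w)))) u w).
      apply (is_derive_comp de (fun u => w * (u - (t1 - u0 / w)))); [apply Hde|].
      auto_derive; [trivial|reflexivity].
    - rewrite <- Hw2. unfold scal; simpl; unfold mult; simpl. ring. }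
  assert (Hdy2 : forall u, dy u ^ 2 = nu ^ 2 * Q (y u)).
  { intros u. unfold dy, y. rewrite Rpow_mult_distr, Heq, Hw2. reflexivity. }
  assert (Hdyturn : forall u, dy u = 0 -> dQ (y u) <> 0).
  { intros u E. apply Hturn. apply (Rmult_eq_reg_l w); [|exact Hw]. fold (dy u). rewrite E.
    ring. }
  assert (Hyt1 : y t1 = e u0) by (unfold y; f_equal; field; exact Hw).
  assert (Hdyt1 : dy t1 = w * de u0) by (unfold dy; do 2 f_equal; field; exact Hw).
  assert (Hcy : forall u, continuous y u).
  { intros u. apply (ex_derive_continuous y). eexists. apply Hy. }
  assert (Hcdy : forall u, continuous dy u).
  { intros u. apply (ex_derive_continuous dy). eexists. apply Hdy. }
  assert (Ey : forall u, e (w * (u - (t1 - u0 / w))) = y u) by reflexivity.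
  clearbody y dy.
  set (W := fun u => s u * (B0 + B1 * y u) - (A0 + A1 * y u)).
  set (dW := fun u => ds u * (B0 + B1 * y u) + s u * (B1 * dy u) - A1 * dy u).
  assert (HdW : forall u, in_interval lo hi u -> is_derive W u (dW u)).
  { intros u Hu. destruct (Hs u Hu) as [h _]. pose proof (Hy u) as h'. unfold W, dW.
    auto_derive.
    - repeat split; (eexists; eassumption).
    - replace (Derive (fun x => s x) u) with (ds u) by (symmetry; apply is_derive_unique, h).
      replace (Derive (fun x => y x) u) with (dy u) by (symmetry; apply is_derive_unique,
        h'). ring. }
  set (A := fun u => W u = 0 /\ dW u = 0 /\ dds u = dP (s u) / 2).
  assert (HA : forall u, in_interval lo hi u -> A u).
  { apply (interval_connected lo hi A t1); [| |exact H1|].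
    - intros u Hu (hW&hdW&h2).
      assert (HB : B0 + B1 * y u <> 0) by (apply (mobius_denominator (s u));
        unfold W in hW; lra).
      assert (HBc : continuous (fun u => B0 + B1 * y u) u) by (pose proof (Hcy u);
        continuity_of_polynomial).
      assert (HBl := continuous_nonzero _ _ HBc HB).
      set (E := fun u => (A0 + A1 * y u) / (B0 + B1 * y u)).
      set (dE := fun u => delta * dy u / (B0 + B1 * y u) ^ 2).
      assert (HE : locally u (fun u => is_derive E u (dE u) /\ is_derive dE u (dP (E u) / 2))).
      { revert HBl. apply filter_imp. intros v Hv. pose proof (Hy v) as h1.
        pose proof (Hdy v) as h3.
        split.
        - unfold E, dE. auto_derive.
          + repeat split; try (eexists; eassumption). exact Hv.
          + replace (Derive (fun x => y x) v) with (dy v) by (symmetry;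
              apply is_derive_unique, h1).
            field. exact Hv.
        - unfold dE. unfold E. rewrite <- mobius_second_order by exact Hv. auto_derive.
          + repeat split; try (eexists; eassumption).
            change ((B0 + B1 * y v) ^ 2 <> 0). nonzero.
          + replace (Derive (fun x => y x) v) with (dy v) by (symmetry;
              apply is_derive_unique, h1).
            replace (Derive (fun x => dy x) v) with (nu ^ 2 * (dQ (y v) / 2)) by (symmetry;
              apply is_derive_unique, h3).
            replace (2 * B1 * nu ^ 2 * Q (y v)) with (2 * B1 * dy v ^ 2) by (rewrite Hdy2;
              ring). field. exact Hv. }
      assert (Esu : s u = E u).
      { unfold E. apply (Rmult_eq_reg_r (B0 + B1 * y u)); [|exact HB]. unfold W in hW.
        field_simplify; lra. }
      assert (Edu : ds u = dE u).
      { unfold dE. apply (Rmult_eq_reg_r ((B0 + B1 * y u)^2)); [|apply pow_nonzero; exact HB].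
        transitivity ((ds u * (B0 + B1 * y u)) * (B0 + B1 * y u)); [ring|].
        replace (ds u * (B0 + B1 * y u)) with ((A1 - s u * B1) * dy u)
          by (unfold dW in hdW; lra).
        rewrite Esu. unfold E. field. exact HB. }
      assert (Hsol : locally u (solves k p q r t s ds dds)).
      { generalize (in_interval_locally lo hi u Hu). apply filter_imp. exact Hs. }
      (* At a turning point of the candidate [P'] does not vanish, as [dQ] does not. *)
      assert (Hmov : ds u <> 0 \/ dds u <> 0).
      { destruct (Req_dec (ds u) 0) as [Z|Z]; [right|left; exact Z].
        assert (Zy : dy u = 0).
        { rewrite Edu in Z. unfold dE in Z. apply (Rmult_eq_reg_l (delta / (B0 + B1 * y u)^2)).
          - rewrite Rmult_0_r, <- Z. field. exact HB.
          - nonzero. }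
        pose proof (Hdyturn u Zy) as Hq. pose proof (Hdy2 u) as Hq2. rewrite Zy in Hq2.
        rewrite h2, Esu. unfold E. rewrite <- mobius_second_order by exact HB.
        assert (HQ0 : Q (y u) = 0).
        { apply (Rmult_eq_reg_l (nu ^ 2)); [lra|apply pow_nonzero, Hnu]. }
        rewrite HQ0.
        replace (delta * (nu ^ 2 * (dQ (y u) / 2) * (B0 + B1 * y u) - 2 * B1 * nu ^ 2 * 0)
                 / (B0 + B1 * y u) ^ 3)
          with (delta * nu ^ 2 * dQ (y u) * / (2 * (B0 + B1 * y u) ^ 2)) by (field; exact HB).
        nonzero. }
      assert (Hnear := second_order_nearby k p q r t s ds dds u Hsol h2 Hmov).
      assert (Hcs : continuous s u).
      { destruct (Hs u Hu) as [g _]. apply (ex_derive_continuous s). eexists. exact g. }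
      assert (HcE : continuous E u).
      { apply (ex_derive_continuous E). eexists. exact (proj1 (locally_singleton _ _ HE)). }
      destruct (dquartic_lipschitz k p q r t s E u Hcs HcE) as (c&Hc0&Hc).
      assert (Hag : locally u (fun u => s u = E u)).
      { apply (second_order_unique (fun x => dP x / 2) s ds E dE c); try assumption.
        generalize (filter_and _ _ Hsol Hnear). apply filter_imp.
        intros v ((g1&g2&_&_)&g3). split; [exact g1|]. rewrite <- g3. exact g2. }
      assert (HW0 : locally u (fun u => W u = 0)).
      { generalize (filter_and _ _ Hag HBl). apply filter_imp. intros v [g1 g2].
        unfold W. rewrite g1. unfold E. field. exact g2. }
      generalize (filter_and _ _ (filter_and _ _ (locally_locally _ _ HW0)
                    (in_interval_locally lo hi u Hu)) Hnear).
      apply filter_imp. intros v [[g1 g2] g3]. split; [|split].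
      + exact (locally_singleton _ _ g1).
      + rewrite <- (is_derive_unique _ _ _ (HdW v g2)).
        apply is_derive_unique. apply (is_derive_ext_loc (fun _ => 0)).
        * revert g1. apply filter_imp. intros z Hz. symmetry; exact Hz.
        * exact (is_derive_const 0 v).
      + exact g3.
    - intros u Hu Hn. destruct (Hs u Hu) as (h1&h2&h3&_).
      assert (Hcs : continuous s u) by (apply (ex_derive_continuous s); eexists; exact h1).
      assert (Hcs1 : continuous ds u) by (apply (ex_derive_continuous ds); eexists; exact h2).
      pose proof (Hcy u). pose proof (Hcdy u).
      assert (CW : continuous W u) by (unfold W; continuity_of_polynomial).
      assert (CdW : continuous dW u) by (unfold dW; continuity_of_polynomial).
      assert (Cd : continuous (fun u => dds u - dP (s u) * / 2) u).
      { assert (continuous (fun u => dP (s u)) u).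
        { apply (continuous_comp s dP); [exact Hcs|apply dquartic_continuous]. }
        continuity_of_polynomial. }
      destruct (Req_dec (W u) 0) as [Z|Z].
      2: { generalize (continuous_nonzero _ _ CW Z). apply filter_imp. intros v Hv (g&_).
           contradiction. }
      destruct (Req_dec (dW u) 0) as [Z'|Z'].
      2: { generalize (continuous_nonzero _ _ CdW Z'). apply filter_imp.
           intros v Hv (_&g&_). contradiction. }
      assert (Z'' : dds u - dP (s u) * / 2 <> 0).
      { intros E. apply Hn. split; [exact Z|split; [exact Z'|]]. unfold Rdiv. lra. }
      generalize (continuous_nonzero _ _ Cd Z''). apply filter_imp. intros v Hv (_&_&g).
      apply Hv. rewrite g. unfold Rdiv. ring.
    - split; [|split].
      + unfold W. rewrite Hyt1. lra.
      + unfold dW. rewrite Hyt1, Hdyt1.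
        pose proof (mobius_denominator _ _ Hu0) as HB.
        replace (s t1) with ((A0 + A1 * e u0) / (B0 + B1 * e u0)) by (rewrite <- Hu0;
          field; exact HB).
        rewrite Hs1. field. exact HB.
      + apply (second_order_where_moving k p q r t s ds dds); [|exact Hm].
        generalize (in_interval_locally lo hi t1 H1). apply filter_imp. exact Hs. }
  intros u Hu. destruct (HA u Hu) as [hW _].
  assert (HB : B0 + B1 * y u <> 0) by (apply (mobius_denominator (s u)); unfold W in hW; lra).
  rewrite Ey. split; [exact HB|]. unfold W in hW. apply (Rmult_eq_reg_r (B0 + B1 * y u));
    [|exact HB]. field_simplify; lra.
Qed.
End Mobius.

(** * Real solutions of the elliptic equation *)

Section Solutions.
Context (lo hi : Rbar) (s ds dds : R -> R) (t1 : R).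
Context (H1 : in_interval lo hi t1) (Hm : ds t1 <> 0).
Definition solution (k p q r t : R) : Prop :=
  forall u, in_interval lo hi u -> solves k p q r t s ds dds u.

(** The map [y |-> (p (1 + y) - q u (1 - y)) / ((1 + y) - u (1 - y))] carries 1 to [p]
    and -1 to [q]; the sign of [u] selects the arc that is the image of (-1, 1).
    The point sent to [s t1] solves [(1 - y) / (1 + y) = R]. *)
Lemma mobius_parameter (p q u : R) : u <> 0 -> s t1 <> q ->
  0 < (s t1 - p) / ((s t1 - q) * u) ->
  let R := (s t1 - p) / ((s t1 - q) * u) in let y := (1 - R) / (1 + R) in
  -1 < y < 1 /\ s t1 * (1 - u + (1 + u) * y) = p - q * u + (p + q * u) * y.
Proof.
  intros hu hq hR R y. fold R in hR.
  assert (E : s t1 - p = (s t1 - q) * u * R) by (unfold R; field; split; lra).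
  split.
  - unfold y. split.
    + apply (Rmult_lt_reg_r (1 + R)); [lra|]. unfold Rdiv.
      rewrite Rmult_assoc, Rinv_l by lra. lra.
    + apply (Rmult_lt_reg_r (1 + R)); [lra|]. unfold Rdiv.
      rewrite Rmult_assoc, Rinv_l by lra. lra.
  - apply (Rmult_eq_reg_r ((1 + R) / 2)); [|lra].
    transitivity (s t1 - s t1 * u * R); [unfold y; field; lra|].
    transitivity (p - q * u * R); [lra|unfold y; field; lra].
Qed.

(** The roots [p], [q], [r], [t] correspond to [y] = 1, -1, 1/kap, -1/kap.  The places
    of [r] and [t] give [u = - X (p - r) / (q - r)] and [kap = (X - 1) / (X + 1)], where
    [X^2] is the cross-ratio below.  The sign hypotheses say that [nu^2] is positive
    and that [s t1] lies in the arc between [p] and [q] free of other roots.  A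
    cross-ratio equal to 1 means [r = t], and then [kap = 0]. *)
Lemma jacobi_sn_case (k p q r t : R) : solution k p q r t ->
  p <> q -> 1 <= (q - r) * (p - t) / ((p - r) * (q - t)) ->
  k * (p - t) * (q - r) < 0 ->
  (s t1 - p) * (s t1 - q) * ((p - r) * (q - r)) < 0 ->
  exists kap, 0 <= kap < 1 /\ (1 < (q - r) * (p - t) / ((p - r) * (q - t)) -> 0 < kap) /\
    jacobi_form kap lo hi s.
Proof.
  intros Hs hpq hX hnu hsig.
  set (X2 := (q - r) * (p - t) / ((p - r) * (q - t))) in *. set (X := sqrt X2).
  assert (hXX : X ^ 2 = X2) by (apply pow2_sqrt; lra).
  assert (hX1 : 1 <= X) by (rewrite <- sqrt_1; apply sqrt_le_1; lra).
  assert (hpt : p - t <> 0) by (intros Z; rewrite Z in hnu; lra).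
  assert (hqr : q - r <> 0) by (intros Z; rewrite Z in hnu; lra).
  assert (hpr : p - r <> 0) by (intros Z; rewrite Z in hsig; lra).
  assert (hsq : s t1 - q <> 0) by (intros Z; rewrite Z in hsig; lra).
  assert (hsp : s t1 - p <> 0) by (intros Z; rewrite Z in hsig; lra).
  assert (hqt : q - t <> 0).
  { intros Z. unfold X2 in hX. rewrite Z, Rmult_0_r in hX. unfold Rdiv in hX.
    rewrite Rinv_0 in hX. lra. }
  set (kap := (X - 1) / (X + 1)).
  assert (hkap : 0 <= kap < 1).
  { unfold kap. split; [apply Rdiv_le_0_compat; lra|]. apply (Rmult_lt_reg_r (X + 1)); [lra|].
    unfold Rdiv. rewrite Rmult_assoc, Rinv_l by lra. lra. }
  set (u := - X * (p - r) / (q - r)).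
  assert (hu : u <> 0) by (unfold u; nonzero).
  set (nu2 := - (k * (p - t) * (q - r)) * (1 + X) ^ 2 / (4 * X ^ 2)).
  assert (hnu2 : 0 < nu2).
  { unfold nu2. apply Rdiv_lt_0_compat; [apply Rmult_lt_0_compat; [lra|apply pow_lt; lra]|].
    apply Rmult_lt_0_compat; [lra|apply pow_lt; lra]. }
  assert (hnn : sqrt nu2 ^ 2 = nu2) by (apply pow2_sqrt; lra).
  destruct (amplitude_exists kap ltac:(lra)) as (am & dn & Ha).
  destruct (mobius_parameter p q u hu ltac:(lra)) as [hy hinit].
  { replace ((s t1 - p) / ((s t1 - q) * u)) with
      (- ((s t1 - p) * (s t1 - q) * ((p - r) * (q - r))) / ((s t1 - q) ^ 2 * X * (p - r) ^ 2))
      by (unfold u; field; repeat split; try assumption; lra).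
    apply Rdiv_lt_0_compat; [lra|].
    positive. }
  destruct (sn_onto kap am dn Ha _ hy) as [u0 Hu0].
  exists kap. split; [exact hkap|split].
  { intros hX'. assert (1 < X) by (rewrite <- sqrt_1; apply sqrt_lt_1; lra).
    unfold kap. apply Rdiv_lt_0_compat; lra. }
  destruct (mobius_solution k p q r t (sn am) (fun v => cn am v * dn v)
      (sn_quartic kap) (dsn_quartic kap) (p - q * u) (p + q * u) (1 - u) (1 + u) (sqrt nu2))
    with (lo := lo) (hi := hi) (s := s) (ds := ds) (dds := dds) (t1 := t1) (u0 := u0)
    as (w & t0 & Hw).
  - apply (sn_derive kap am dn Ha).
  - apply (sn_second_order kap am dn Ha).
  - apply (sn_first_order kap am dn Ha).
  - apply (sn_turning kap am dn Ha).
  - apply sn_quartic_derive.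
  - replace ((p + q * u) * (1 - u) - (p - q * u) * (1 + u)) with (2 * u * (q - p)) by ring.
    nonzero.
  - intros y. rewrite hnn.
    replace (p - q * u + (p + q * u) * y - p * (1 - u + (1 + u) * y))
      with ((p - q) * u * (1 - y)) by ring.
    replace (p - q * u + (p + q * u) * y - q * (1 - u + (1 + u) * y))
      with ((p - q) * (1 + y)) by ring.
    replace (p - q * u + (p + q * u) * y - r * (1 - u + (1 + u) * y))
      with ((p - r) * (1 + X) * (1 - kap * y))
      by (unfold u, kap; field; split; lra).
    replace (p - q * u + (p + q * u) * y - t * (1 - u + (1 + u) * y))
      with ((p - t) * (1 + X) / X * (1 + kap * y)).
    + unfold sn_quartic, nu2, u. field. split; lra.
    + assert (E : u * (q - t) = - (p - t) / X).
      { unfold u. apply (Rmult_eq_reg_r X); [|lra].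
        transitivity (- (p - r) * (q - t) / (q - r) * X ^ 2); [field; assumption|].
        rewrite hXX. unfold X2. field. repeat split; (assumption || lra). }
      transitivity ((p - t) * (1 + y) - u * (q - t) * (1 - y)); [|ring].
      rewrite E. unfold kap. field. split; lra.
  - exact Hs.
  - apply Rgt_not_eq, sqrt_lt_R0, hnu2.
  - exact H1.
  - exact Hm.
  - rewrite Hu0. exact hinit.
  - exists am, (sn am), (p - q * u), (p + q * u), (1 - u), (1 + u), w, t0.
    split; [apply Ha|split; [left; reflexivity|exact Hw]].
Qed.

(** Here 1 and -1 go to the double roots, and [sn] is the hyperbolic tangent; [u = 1] or
    [u = - 1] according as [s t1] lies outside or inside the segment between the roots. *)
Lemma jacobi_tanh_case (k p q : R) : solution k p p q q ->
  p <> q -> s t1 <> p -> s t1 <> q -> 0 < k ->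
  jacobi_form 1 lo hi s.
Proof.
  intros Hs hpq hp hq hk.
  assert (Hu : exists u, u ^ 2 = 1 /\ 0 < (s t1 - p) / ((s t1 - q) * u)).
  { destruct (Rtotal_order ((s t1 - p) / (s t1 - q)) 0) as [Z|[Z|Z]].
    - exists (-1). split; [ring|]. replace ((s t1 - p) / ((s t1 - q) * -1))
        with (- ((s t1 - p) / (s t1 - q))) by (field; lra). lra.
    - exfalso. revert Z. apply Rmult_integral_contrapositive_currified;
        [lra|apply Rinv_neq_0_compat; lra].
    - exists 1. split; [ring|]. rewrite Rmult_1_r. exact Z. }
  destruct Hu as (u & hu2 & hR).
  assert (hu : u <> 0) by (intros Z; rewrite Z in hu2; lra).
  set (nu2 := k * (p - q) ^ 2 / 4).
  assert (hnu2 : 0 < nu2).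
  { unfold nu2. assert (0 < (p - q) ^ 2) by (apply pow2_gt_0; lra).
    pose proof (Rmult_lt_0_compat _ _ hk H). lra. }
  assert (hnn : sqrt nu2 ^ 2 = nu2) by (apply pow2_sqrt; lra).
  destruct (amplitude_exists 1 ltac:(lra)) as (am & dn & Ha).
  destruct (mobius_parameter p q u hu ltac:(lra) hR) as [hy hinit].
  destruct (sn_onto 1 am dn Ha _ hy) as [u0 Hu0].
  destruct (mobius_solution k p p q q (sn am) (fun v => cn am v * dn v)
      (sn_quartic 1) (dsn_quartic 1) (p - q * u) (p + q * u) (1 - u) (1 + u) (sqrt nu2))
    with (lo := lo) (hi := hi) (s := s) (ds := ds) (dds := dds) (t1 := t1) (u0 := u0)
    as (w & t0 & Hw).
  - apply (sn_derive 1 am dn Ha).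
  - apply (sn_second_order 1 am dn Ha).
  - apply (sn_first_order 1 am dn Ha).
  - apply (sn_turning 1 am dn Ha).
  - apply sn_quartic_derive.
  - replace ((p + q * u) * (1 - u) - (p - q * u) * (1 + u)) with (2 * u * (q - p)) by ring.
    nonzero.
  - intros y. rewrite hnn. unfold nu2, sn_quartic. field.
  - exact Hs.
  - apply Rgt_not_eq, sqrt_lt_R0, hnu2.
  - exact H1.
  - exact Hm.
  - rewrite Hu0. exact hinit.
  - exists am, (sn am), (p - q * u), (p + q * u), (1 - u), (1 + u), w, t0.
    split; [apply Ha|split; [left; reflexivity|exact Hw]].
Qed.

(** The double root [d] corresponds to [y = 0].  As [cn] is positive for modulus 1, only the
    part of the arc between [p] and [d] is reached: this is the upper bound 1. *)
Lemma jacobi_sech_case_half (k d p q : R) : solution k d d p q ->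
  p <> q -> s t1 <> q -> 0 < k * ((p - d) * (q - d)) ->
  0 < (s t1 - p) * (q - d) / ((s t1 - q) * (p - d)) < 1 ->
  jacobi_form 1 lo hi s.
Proof.
  intros Hs hpq hq hk hR.
  assert (hpd : p - d <> 0) by (intros Z; rewrite Z in hk; lra).
  assert (hqd : q - d <> 0) by (intros Z; rewrite Z in hk; lra).
  set (u := (p - d) / (q - d)).
  assert (hu : u <> 0) by (unfold u; nonzero).
  set (nu2 := k * ((p - d) * (q - d))) in *.
  assert (hnn : sqrt nu2 ^ 2 = nu2) by (apply pow2_sqrt; lra).
  destruct (amplitude_exists 1 ltac:(lra)) as (am & dn & Ha).
  replace ((s t1 - p) * (q - d) / ((s t1 - q) * (p - d)))
    with ((s t1 - p) / ((s t1 - q) * u)) in hR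
    by (unfold u; field; repeat split; lra).
  destruct (mobius_parameter p q u hu ltac:(lra) (proj1 hR)) as [hy hinit].
  assert (hy0 : 0 < (1 - (s t1 - p) / ((s t1 - q) * u)) / (1 + (s t1 - p) / ((s t1 - q) * u)))
    by (apply Rdiv_lt_0_compat; lra).
  destruct (cn1_onto am dn Ha _ (conj hy0 (proj2 hy))) as [u0 Hu0].
  destruct (mobius_solution k d d p q (cn am) (fun v => - sn am v * dn v)
      cn1_quartic dcn1_quartic (p - q * u) (p + q * u) (1 - u) (1 + u) (sqrt nu2))
    with (lo := lo) (hi := hi) (s := s) (ds := ds) (dds := dds) (t1 := t1) (u0 := u0)
    as (w & t0 & Hw).
  - apply (cn_derive 1 am dn Ha).
  - apply (cn1_second_order am dn Ha).
  - apply (cn1_first_order am dn Ha).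
  - apply (cn1_turning am dn Ha).
  - apply cn1_quartic_derive.
  - replace ((p + q * u) * (1 - u) - (p - q * u) * (1 + u)) with (2 * u * (q - p)) by ring.
    nonzero.
  - intros y. rewrite hnn. unfold nu2, cn1_quartic, u. field. lra.
  - exact Hs.
  - apply Rgt_not_eq, sqrt_lt_R0. exact hk.
  - exact H1.
  - exact Hm.
  - rewrite Hu0. exact hinit.
  - exists am, (cn am), (p - q * u), (p + q * u), (1 - u), (1 + u), w, t0.
    split; [apply Ha|split; [right; reflexivity|exact Hw]].
Qed.

Lemma solution_perm k p q r t k' p' q' r' t' :
  (forall x, quartic k p q r t x = quartic k' p' q' r' t' x) ->
  solution k p q r t -> solution k' p' q' r' t'.
Proof.
  intros E Hs u Hu. destruct (Hs u Hu) as (a1&a2&a3&a4). rewrite E in a4.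
  exact (conj a1 (conj a2 (conj a3 a4))).
Qed.

Lemma moving_positive k p q r t : solution k p q r t -> 0 < quartic k p q r t (s t1).
Proof.
  intros Hs. destruct (Hs t1 H1) as (_&_&_&E). rewrite <- E. apply pow2_gt_0, Hm.
Qed.

(** Exchanging [p] and [q] inverts the ratio that [jacobi_sech_case_half] bounds by 1;
    the ratio is 1 only at the double root. *)
Lemma jacobi_sech_case (k d p q : R) : solution k d d p q -> p <> q ->
  0 < k * ((p - d) * (q - d)) -> jacobi_form 1 lo hi s.
Proof.
  intros Hs hpq hk.
  pose proof (moving_positive _ _ _ _ _ Hs) as hP. unfold quartic in hP.
  assert (hpd : p - d <> 0) by (intros Z; rewrite Z in hk; lra).
  assert (hqd : q - d <> 0) by (intros Z; rewrite Z in hk; lra).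
  assert (hk0 : k <> 0) by (intros Z; rewrite Z in hP; lra).
  assert (hsd : s t1 - d <> 0) by (intros Z; rewrite Z in hP; lra).
  assert (hsp : s t1 - p <> 0) by (intros Z; rewrite Z in hP; lra).
  assert (hsq : s t1 - q <> 0) by (intros Z; rewrite Z in hP; lra).
  set (R := (s t1 - p) * (q - d) / ((s t1 - q) * (p - d))).
  assert (hR : 0 < R).
  { replace R with ((k * (s t1 - d) * (s t1 - d) * (s t1 - p) * (s t1 - q)) * (k *
      ((p - d) * (q - d))) /
      (k ^ 2 * (s t1 - d) ^ 2 * (s t1 - q) ^ 2 * (p - d) ^ 2)).
    - apply Rdiv_lt_0_compat; [apply Rmult_lt_0_compat; assumption|].
      positive.
    - unfold R. field. repeat split; assumption. }
  destruct (Rtotal_order R 1) as [L|[L|L]].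
  - apply (jacobi_sech_case_half k d p q); try assumption; [lra|split; assumption].
  - exfalso. assert (E : (s t1 - d) * (q - p) = 0).
    { replace ((s t1 - d) * (q - p)) with ((R - 1) * ((s t1 - q) * (p - d))) by (unfold R;
        field; lra). rewrite L. ring. }
    revert E. apply Rmult_integral_contrapositive_currified; lra.
  - apply (jacobi_sech_case_half k d q p).
    + revert Hs. apply solution_perm. intros x. unfold quartic. ring.
    + auto.
    + lra.
    + lra.
    + replace ((s t1 - q) * (p - d) / ((s t1 - p) * (q - d))) with (/ R) by (unfold R;
        field; lra).
      split; [apply Rinv_0_lt_compat; lra|]. rewrite <- Rinv_1. apply Rinv_lt_contravar; lra.
Qed.

(** The sign of [P] divided by [(s - d)^2] at [d] decides: where it is negative, [s]
    oscillates away from the double root (a trigonometric solution); where it is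
    positive, [s] is asymptotic to it (a hyperbolic one). *)
Lemma jacobi_double_root (k d p q : R) : solution k d d p q -> p <> q -> p <> d -> q <> d ->
  exists kap, 0 <= kap <= 1 /\ jacobi_form kap lo hi s.
Proof.
  intros Hs hpq hpd hqd.
  pose proof (moving_positive _ _ _ _ _ Hs) as hP. unfold quartic in hP.
  assert (hk : k <> 0) by (intros Z; rewrite Z in hP; lra).
  assert (hsd : s t1 - d <> 0) by (intros Z; rewrite Z in hP; lra).
  destruct (Rtotal_order (k * ((p - d) * (q - d))) 0) as [L|[L|L]].
  - destruct (jacobi_sn_case k p q d d) as (kap & h1 & _ & h2).
    + revert Hs. apply solution_perm. intros x. unfold quartic. ring.
    + exact hpq.
    + right. field. lra.
    + lra.
    + set (S2 := (s t1 - d) ^ 2).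
      assert (0 < S2) by (apply pow2_gt_0; exact hsd).
      assert (0 < k ^ 2) by (apply pow2_gt_0; exact hk).
      apply (Rmult_lt_reg_l (k ^ 2 * S2)); [apply Rmult_lt_0_compat; assumption|].
      rewrite Rmult_0_r.
      replace (k ^ 2 * S2 * ((s t1 - p) * (s t1 - q) * ((p - d) * (q - d)))) with
        ((k * (s t1 - d) * (s t1 - d) * (s t1 - p) * (s t1 - q)) * (k * ((p - d) *
          (q - d)))) by (unfold S2; ring).
      apply Rmult_pos_neg; assumption.
    + exists kap. split; [lra|exact h2].
  - exfalso. assert (k * ((p - d) * (q - d)) <> 0) by nonzero. contradiction.
  - exists 1. split; [lra|]. exact (jacobi_sech_case k d p q Hs hpq L).
Qed.

(** The product in the first sign condition is the cross-ratio minus 1, up to a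
    square. *)
Lemma jacobi_sn_case_simple (k p q r t : R) : solution k p q r t -> p <> q ->
  0 < (q - p) * (r - t) * ((p - r) * (q - t)) -> k * (p - t) * (q - r) < 0 ->
  (s t1 - p) * (s t1 - q) * ((p - r) * (q - r)) < 0 ->
  exists kap, 0 < kap < 1 /\ jacobi_form kap lo hi s.
Proof.
  intros Hs hpq hX h1 h2.
  assert (h0 : (p - r) * (q - t) <> 0) by (intros Z; rewrite Z in hX; lra).
  assert (hX1 : 1 < (q - r) * (p - t) / ((p - r) * (q - t))).
  { assert (0 < (q - r) * (p - t) / ((p - r) * (q - t)) - 1); [|lra].
    replace ((q - r) * (p - t) / ((p - r) * (q - t)) - 1) with ((q - p) * (r - t) *
      ((p - r) * (q - t)) / ((p - r) * (q - t)) ^ 2).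
    - apply Rdiv_lt_0_compat; [exact hX|apply pow2_gt_0; exact h0].
    - field. split; intros Z; apply h0; rewrite Z; ring. }
  destruct (jacobi_sn_case k p q r t Hs hpq (Rlt_le _ _ hX1) h1 h2) as (kap & h3 & h4 & h5).
  exists kap. specialize (h4 hX1). split; [lra|exact h5].
Qed.

(** In each of the intervals cut by the roots [P (s t1) > 0] gives the sign of [k], and
    the two roots adjacent to [s t1] on the projective line are taken for [p] and
    [q]; the two unbounded intervals form a single arc, from [r4] to [r1]. *)
Lemma jacobi_simple_roots (k r1 r2 r3 r4 : R) :
  solution k r1 r2 r3 r4 -> r1 < r2 < r3 -> r3 < r4 ->
  exists kap, 0 < kap < 1 /\ jacobi_form kap lo hi s.
Proof.
  intros Hs h12 h34.
  pose proof (moving_positive _ _ _ _ _ Hs) as hP. unfold quartic in hP.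
  set (x := s t1) in *.
  assert (hx : x <> r1 /\ x <> r2 /\ x <> r3 /\ x <> r4).
  { repeat split; intros Z; rewrite Z in hP; lra. }
  assert (Hperm : forall p q r t,
    (forall x, quartic k r1 r2 r3 r4 x = quartic k p q r t x) -> solution k p q r t).
  { intros p q r t E. revert Hs. apply solution_perm, E. }
  destruct (Rlt_dec x r1) as [L1|L1]; [|destruct (Rlt_dec x r2) as [L2|L2];
    [|destruct (Rlt_dec x r3) as [L3|L3]; [|destruct (Rlt_dec x r4) as [L4|L4]]]].
  - assert (0 < k).
    { assert (E : 0 < (r1 - x) * (r2 - x) * (r3 - x) * (r4 - x)) by positive.
      apply (Rmult_lt_reg_r _ _ _ E). lra. }
    apply (jacobi_sn_case_simple k r4 r1 r3 r2); [apply Hperm; intros; unfold quartic;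
      ring|lra|..]; fold x.
    + assert (0 < (r4 - r1) * (r3 - r2) * (r4 - r3) * (r2 - r1)) by positive. lra.
    + assert (0 < k * (r4 - r2) * (r3 - r1) * 1) by positive. lra.
    + assert (0 < (r4 - x) * (r1 - x) * (r4 - r3) * (r3 - r1)) by positive. lra.
  - assert (k < 0).
    { assert (E : 0 < (x - r1) * (r2 - x) * (r3 - x) * (r4 - x)) by positive.
      apply (Rmult_lt_reg_r _ _ _ E). lra. }
    apply (jacobi_sn_case_simple k r1 r2 r4 r3); [apply Hperm; intros; unfold quartic;
      ring|lra|..]; fold x.
    + assert (0 < (r2 - r1) * (r4 - r3) * (r4 - r1) * (r3 - r2)) by positive. lra.
    + assert (0 < (-k) * (r3 - r1) * (r4 - r2) * 1) by positive. lra.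
    + assert (0 < (x - r1) * (r2 - x) * (r4 - r1) * (r4 - r2)) by positive. lra.
  - assert (0 < k).
    { assert (E : 0 < (x - r1) * (x - r2) * (r3 - x) * (r4 - x)) by positive.
      apply (Rmult_lt_reg_r _ _ _ E). lra. }
    apply (jacobi_sn_case_simple k r2 r3 r1 r4); [apply Hperm; intros; unfold quartic;
      ring|lra|..]; fold x.
    + assert (0 < (r3 - r2) * (r4 - r1) * (r2 - r1) * (r4 - r3)) by positive. lra.
    + assert (0 < k * (r4 - r2) * (r3 - r1) * 1) by positive. lra.
    + assert (0 < (x - r2) * (r3 - x) * (r2 - r1) * (r3 - r1)) by positive. lra.
  - assert (k < 0).
    { assert (E : 0 < (x - r1) * (x - r2) * (x - r3) * (r4 - x)) by positive.
      apply (Rmult_lt_reg_r _ _ _ E). lra. }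
    apply (jacobi_sn_case_simple k r3 r4 r2 r1); [apply Hperm; intros; unfold quartic;
      ring|lra|..]; fold x.
    + assert (0 < (r4 - r3) * (r2 - r1) * (r3 - r2) * (r4 - r1)) by positive. lra.
    + assert (0 < (-k) * (r3 - r1) * (r4 - r2) * 1) by positive. lra.
    + assert (0 < (x - r3) * (r4 - x) * (r3 - r2) * (r4 - r2)) by positive. lra.
  - assert (0 < k).
    { assert (E : 0 < (x - r1) * (x - r2) * (x - r3) * (x - r4)) by positive.
      apply (Rmult_lt_reg_r _ _ _ E). lra. }
    apply (jacobi_sn_case_simple k r4 r1 r3 r2); [apply Hperm; intros; unfold quartic;
      ring|lra|..]; fold x.
    + assert (0 < (r4 - r1) * (r3 - r2) * (r4 - r3) * (r2 - r1)) by positive. lra.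
    + assert (0 < k * (r4 - r2) * (r3 - r1) * 1) by positive. lra.
    + assert (0 < (x - r4) * (x - r1) * (r4 - r3) * (r3 - r1)) by positive. lra.
Qed.
End Solutions.

Lemma constant_jacobi_form lo hi (s : R -> R) :
  (forall t, in_interval lo hi t -> is_derive s t 0) -> jacobi_form (1/2) lo hi s.
Proof.
  intros Hs.
  destruct (amplitude_exists (1/2) ltac:(lra)) as (am & dn & Ha).
  assert (Hc : exists v, forall t, in_interval lo hi t -> s t = v).
  { destruct (classic (exists t, in_interval lo hi t)) as [[t0 H0]|H0].
    - exists (s t0). intros t Ht. exact (constant_of_zero_derivative lo hi s t t0 Hs Ht H0).
    - exists 0. intros t Ht. exfalso. apply H0. exists t. exact Ht. }
  destruct Hc as [v Hv].
  exists am, (sn am), v, 0, 1, 0, 1, 0. split; [apply Ha|split; [left; reflexivity|]].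
  intros t Ht. rewrite Rmult_0_l, Rplus_0_r. split; [lra|]. rewrite (Hv t Ht). field.
Qed.

(** The two roots of [Phi] are distinct, so at most two double roots can occur, and
    then only at [c] or [- c]. *)
Lemma separated_elliptic (c m l : R) lo hi s : 0 < c -> m <> 0 ->
  separated_equation c m l lo hi s -> elliptic_in_time c m l lo hi s.
Proof.
  intros hc hm (ds & dds & Hs).
  destruct (classic (exists t1, in_interval lo hi t1 /\ ds t1 <> 0)) as [(t1 & H1 & Hm)|Hrest].
  2: { exists (1/2). split; [lra|split; [intros; lra|]]. apply constant_jacobi_form.
       intros t Ht.
       destruct (Hs t Ht) as [h1 _]. replace 0 with (ds t); [exact h1|].
       destruct (Req_dec (ds t) 0) as [Z|Z]; [exact Z|]. exfalso. apply Hrest. exists t.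
       split; assumption. }
  set (f1 := (l + 1) / (2 * m)). set (f2 := (l - 1) / (2 * m)).
  assert (HPhi : forall x, Phi m l x = 4 * m * (x - f1) * (x - f2)).
  { intros x. unfold Phi, f1, f2. field. exact hm. }
  assert (Hf : f1 <> f2).
  { intros E. assert (1 / m = 0). { transitivity (f1 - f2); [unfold f1, f2; field;
      exact hm|lra]. }
    revert H. unfold Rdiv. rewrite Rmult_1_l. apply Rinv_neq_0_compat, hm. }
  assert (Hord : exists x y, x < y /\ forall z, (z - f1) * (z - f2) = (z - x) * (z - y)).
  { destruct (Rtotal_order f1 f2) as [L|[L|L]]; [exists f1, f2|contradiction|exists f2, f1];
    (split; [exact L|intros; ring]). }
  destruct Hord as (x & y & Hxy & Hfac).
  assert (HPhi2 : forall z, Phi m l z = 4 * m * ((z - x) * (z - y))).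
  { intros z. rewrite HPhi, <- Hfac. ring. }
  assert (Hsol : solution lo hi s ds dds (- m) (- c) c x y).
  { intros t Ht. destruct (Hs t Ht) as (h1&h2&h3&h4).
    split; [exact h1|split; [exact h2|split; [exact h3|]]].
    rewrite HPhi2 in h4. unfold quartic. lra. }
  clear Hs HPhi Hfac. clearbody f1 f2.
  assert (Hperm : forall p q r t,
    (forall z, quartic (- m) (- c) c x y z = quartic (- m) p q r t z) ->
    solution lo hi s ds dds (- m) p q r t).
  { intros p q r t E. revert Hsol. apply solution_perm, E. }
  assert (Hdeg : (exists kap, 0 <= kap <= 1 /\ jacobi_form kap lo hi s) ->
    (x = c \/ y = c \/ x = - c \/ y = - c) -> elliptic_in_time c m l lo hi s).
  { intros (kap & hk & hj) hd. exists kap. split; [exact hk|split; [|exact hj]].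
    intros P1 P2. exfalso. rewrite HPhi2 in P1, P2. destruct hd as [E|[E|[E|E]]];
    [apply P1|apply P1|apply P2|apply P2]; rewrite E; ring. }
  assert (Hsimple : (exists kap, 0 < kap < 1 /\ jacobi_form kap lo hi s) ->
    elliptic_in_time c m l lo hi s).
  { intros (kap & hk & hj). exists kap. split; [lra|split; [intros; exact hk|exact hj]]. }
  destruct (Req_dec x c) as [Exc|Exc]; [|destruct (Req_dec y c) as [Eyc|Eyc]].
  - apply Hdeg; [|tauto].
    apply (jacobi_double_root lo hi s ds dds t1 H1 Hm (- m) c (- c) y); try lra.
    apply Hperm. intros z. unfold quartic. rewrite Exc. ring.
  - destruct (Req_dec x (- c)) as [E|E].
    + apply Hdeg; [|tauto]. exists 1. split; [lra|].
      assert (Ht : solution lo hi s ds dds (- m) (- c) (- c) c c).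
      { apply Hperm. intros z. unfold quartic. rewrite E, Eyc. ring. }
      pose proof (moving_positive lo hi s ds dds t1 H1 Hm _ _ _ _ _ Ht) as hP.
      unfold quartic in hP.
      apply (jacobi_tanh_case lo hi s ds dds t1 H1 Hm (- m) (- c) c Ht); try lra.
      * intros Z; rewrite Z in hP; lra.
      * intros Z; rewrite Z in hP; lra.
      * apply (Rmult_lt_reg_r (((s t1 + c) * (s t1 - c)) ^ 2)); [|lra].
        apply pow2_gt_0. intros Z.
        replace (- m * (s t1 - - c) * (s t1 - - c) * (s t1 - c) * (s t1 - c))
          with (- m * ((s t1 + c) * (s t1 - c)) ^ 2) in hP by ring.
        rewrite Z in hP. lra.
    + apply Hdeg; [|tauto].
      apply (jacobi_double_root lo hi s ds dds t1 H1 Hm (- m) c (- c) x); try lra.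
      apply Hperm. intros z. unfold quartic. rewrite Eyc. ring.
  - destruct (Req_dec x (- c)) as [Ex|Ex]; [|destruct (Req_dec y (- c)) as [Ey|Ey]].
    + apply Hdeg; [|tauto].
      apply (jacobi_double_root lo hi s ds dds t1 H1 Hm (- m) (- c) c y); try lra.
      apply Hperm. intros z. unfold quartic. rewrite Ex. ring.
    + apply Hdeg; [|tauto].
      apply (jacobi_double_root lo hi s ds dds t1 H1 Hm (- m) (- c) c x); try lra.
      apply Hperm. intros z. unfold quartic. rewrite Ey. ring.
    + apply Hsimple.
      assert (Hgo : forall r1 r2 r3 r4, (forall z, quartic (- m) (- c) c x y z =
        quartic (- m) r1 r2 r3 r4 z) ->
         r1 < r2 < r3 -> r3 < r4 -> exists kap, 0 < kap < 1 /\ jacobi_form kap lo hi s).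
      { intros r1 r2 r3 r4 E h12 h34.
        exact (jacobi_simple_roots lo hi s ds dds t1 H1 Hm _ _ _ _ _ (Hperm _ _ _ _ E) h12 h34). }
      destruct (Rlt_dec x (- c)); [|destruct (Rlt_dec x c)];
      (destruct (Rlt_dec y (- c)); [|destruct (Rlt_dec y c)]); try lra.
      * apply (Hgo x y (- c) c); [intros; unfold quartic; ring|lra|lra].
      * apply (Hgo x (- c) y c); [intros; unfold quartic; ring|lra|lra].
      * apply (Hgo x (- c) c y); [intros; unfold quartic; ring|lra|lra].
      * apply (Hgo (- c) x y c); [intros; unfold quartic; ring|lra|lra].
      * apply (Hgo (- c) x c y); [intros; unfold quartic; ring|lra|lra].
      * apply (Hgo (- c) c x y); [intros; unfold quartic; ring|lra|lra].
Qed.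

Theorem theorem3 (a b m l : R) (hb : 0 < b) (hab : b < a) (hm : m <> 0) :
  (forall (lo hi : Rbar) (q : R -> state),
     motion_on lo hi q ->
     (forall t : R, in_interval lo hi t -> J a b m l (q t)) ->
     (forall t : R, in_interval lo hi t -> (x1 (q t) * x2 (q t))%C <> RtoC 0) ->
     (exists sg : R -> R, radical_along a b m l lo hi q sg) /\
     (forall sg : R -> R, radical_along a b m l lo hi q sg ->
        separated_system a b m l lo hi
          (fun t : R => s1 a b (q t) (sg t))
          (fun t : R => s2 a b (q t) (sg t))))
  /\
  (forall (lo hi : Rbar) (u v : R -> R),
     separated_system a b m l lo hi u v ->
     elliptic_in_time a m l lo hi u /\ elliptic_in_time b m l lo hi v).
Proof.
  split.
  - intros lo hi q Hq HJ Hx.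
    assert (Hxx : forall t, in_interval lo hi t -> xx (q t) <> 0).
    { intros t Ht E. apply (Hx t Ht). unfold xx, Re in E.
      apply injective_projections; [exact E|]. unfold x2, x1, Cconj, Cmult; simpl; ring. }
    split.
    + apply (radical_exists a b m l (conj hb hab) hm lo hi q Hq HJ Hxx).
    + intros sg Hsg. apply (reduction_separated a b m l (conj hb hab) hm lo hi q Hq HJ Hxx sg Hsg).
  - intros lo hi u v [Hu Hv]. split; apply separated_elliptic; try assumption; lra.
Qed.
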